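(* Let $\Lambda\subset(0,\infty)$ be finite or countable. Any unitary representation of the group $\mathbb I_\Lambda$ is a subrepresentation in some tensor product $$\bigotimes_{j=1}^N\ell^2(\Xi_{\epsilon_j,r_j}),$$ where the pairs $(\epsilon_j,r_j)$ are $\Lambda$-perfect (and not necessarily distinct).
   Context: An ultrametric space is a metric space with $d(x,z)\le\max(d(x,y),d(y,z))$; its spectrum is its set of nonzero distances. $\mathbb U_\Lambda$ is the ultrametric Urysohn space: the unique (up to isometry) complete separable ultrametric space with spectrum $\Lambda$ such that for any finite ultrametric spaces $X\subset Y$ with spectra in $\Lambda$, each isometric embedding $X\to\mathbb U_\Lambda$ extends to an isometric embedding $Y\to\mathbb U_\Lambda$. $\mathbb I_\Lambda$ is the group of all bijective isometries of $\mathbb U_\Lambda$ with the topology of pointwise convergence (a Polish group). Unitary representations are continuous homomorphisms to the unitary group (strong operator topology) of a separable Hilbert space. Balls: $\mathrm B^c(a,r)=\{x:d(a,x)\le r\}$, $\mathrm B^o(a,r)=\{x:d(a,x)<r\}$. Let $\Lambda^{+0}=\Lambda$ if $0$ is a limit point of $\Lambda$ and $\Lambda^{+0}=\Lambda\cup\{0\}$ otherwise; let $\Lambda^\circ$ be the set of all $r$ for which there is a strictly increasing sequence in $\Lambda$ convergent to $r$. A $\Lambda$-perfect pair is $(c,r)$ with $r\in\Lambda^{+0}$, or $(o,r)$ with $r\in\Lambda^\circ$; if $\Lambda$ is unbounded, $(o,\infty)$ is also allowed, i.e. the whole space is regarded as an open ball of infinite radius. For a perfect pair $(\epsilon,r)$,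 $\Xi_{\epsilon,r}$ is the countable set of all balls $\mathrm B^\epsilon(x,r)$, $x\in\mathbb U_\Lambda$. The group $\mathbb I_\Lambda$ acts on $\Xi_{\epsilon,r}$ by permutations and hence unitarily on the Hilbert space $\ell^2(\Xi_{\epsilon,r})$ of square-summable functions on $\Xi_{\epsilon,r}$.
   Formalization: The theorem is proved for irreducible unitary representations; for arbitrary ones the claim fails, e.g. the trivial representation on C^2 embeds in no such tensor product, whose invariant vectors have dimension at most 1. *)

(* Defs.v *)
From HB Require Import structures.
From mathcomp Require Import all_boot all_order all_algebra.
From mathcomp Require Import all_classical all_reals all_analysis.
From mathcomp Require Import summability.
From mathcomp Require Import complex lra.

Set Implicit Arguments.
Unset Strict Implicit.
Unset Printing Implicit Defensive.

Import Order.TTheory GRing.Theory Num.Def Num.Theory.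
Import numFieldNormedType.Exports.

Local Open Scope classical_set_scope.
Local Open Scope ring_scope.
Local Open Scope complex_scope.

Definition separable_space (T : topologicalType) : Prop :=
  exists2 D : set T, countable D & dense D.

Section Ultrametric.
Variable R : realType.

Definition ultrametric (U : metricType R) : Prop :=
  forall x y z : U, mdist x z <= Num.max (mdist x y) (mdist y z).

Definition spectrum (U : metricType R) : set R :=
  [set r | exists x y : U, x != y /\ mdist x y = r].

(* The structure completeType is not used because it assumes a point; here
   nonemptiness is part of the extension property (take X empty, Y a point). *)
Record urysohn (L : set R) (U : metricType R) : Prop := Urysohn {
  urysohn_ultrametric : ultrametric U;
  urysohn_spectrum : spectrum U = L;
  urysohn_complete : forall F : set_system U,
    ProperFilter F -> cauchy F -> exists x : U, F --> x;
  urysohn_separable : separable_space U;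
  urysohn_extension : forall (Y : metricType R) (X : set Y) (f : X -> U),
    finite_set [set: Y] -> ultrametric Y -> spectrum Y `<=` L ->
    (forall x y : X, mdist (f x) (f y) = mdist (val x) (val y)) ->
    exists2 h : Y -> U, (forall x y : Y, mdist (h x) (h y) = mdist x y)
                      & (forall x : X, h (val x) = f x) }.

End Ultrametric.

Section IsometryGroup.
Variables (R : realType) (U : metricType R).

Definition is_isometry (f : U -> U) : bool :=
  `[< bijective f /\ forall x y, mdist (f x) (f y) = mdist x y >].

Record isom : Type := Isom { isom_fun :> U -> U; _ : is_isometry isom_fun }.

HB.instance Definition _ := [isSub for isom_fun].
HB.instance Definition _ := [Choice of isom by <:].

Lemma isom_bij (g : isom) : bijective g.
Proof. by case: g => f /= /asboolP[]. Qed.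

Lemma isom_mdist (g : isom) x y : mdist (g x) (g y) = mdist x y.
Proof. by case: g => f /= /asboolP[]. Qed.

Lemma isom_ext (g h : isom) : g =1 h -> g = h.
Proof. by move=> gh; apply/val_inj/funext. Qed.

Lemma isom_one_proof : is_isometry id.
Proof. by apply/asboolP; split=> //; exists id. Qed.
Definition isom_one := Isom isom_one_proof.

Lemma isom_mul_proof (g h : isom) : is_isometry (g \o h).
Proof.
apply/asboolP; split; first by apply: bij_comp; exact: isom_bij.
by move=> x y; rewrite /= !isom_mdist.
Qed.
Definition isom_mul (g h : isom) := Isom (isom_mul_proof g h).

Lemma isom_inv_exists (g : isom) :
  exists h : U -> U, [/\ cancel g h, cancel h g & is_isometry h].
Proof.
have [h gh hg] := isom_bij g.
exists h; split=> //; apply/asboolP; split; first by exists g.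
by move=> x y; rewrite -(isom_mdist g) !hg.
Qed.
Definition isom_inv (g : isom) :=
  let: exist h (And3 _ _ hP) := cid (isom_inv_exists g) in Isom hP.

Lemma isom_funK (g : isom) : cancel g (isom_inv g).
Proof. by rewrite /isom_inv; case: cid => h []. Qed.

Lemma isom_invK (g : isom) : cancel (isom_inv g) g.
Proof. by rewrite /isom_inv; case: cid => h []. Qed.

Lemma isom_mulA : associative isom_mul.
Proof. by move=> f g h; apply: isom_ext. Qed.

Lemma isom_mul1 : left_id isom_one isom_mul.
Proof. by move=> g; apply: isom_ext. Qed.

Lemma isom_mulr1 : right_id isom_one isom_mul.
Proof. by move=> g; apply: isom_ext. Qed.

Lemma isom_mulV : left_inverse isom_one isom_inv isom_mul.
Proof. by move=> g; apply: isom_ext => x; exact: isom_funK. Qed.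

Lemma isom_mulrV : right_inverse isom_one isom_inv isom_mul.
Proof. by move=> g; apply: isom_ext => x; exact: isom_invK. Qed.

(* (g * h) x = g (h x), so this is a left action on U. *)
HB.instance Definition _ := isGroup.Build isom
  isom_mulA isom_mul1 isom_mulr1 isom_mulV isom_mulrV.

(* The topology of pointwise convergence. *)
HB.instance Definition _ := Topological.copy isom
  (initial_topology (isom_fun : isom -> {ptws U -> U})).

End IsometryGroup.

Section Hilbert.
Variable R : realType.

(* By the convention of sesquilinear.v, hdot is linear in its first argument and
   conjugate-linear in the second. *)
Record hilbert : Type := Hilbert {
  hspace :> completeNormedModType R[i];
  hdot : {dot hspace for conjC};
  hdot_norm : forall v : hspace, hdot v v = `|v| ^+ 2 }.

Definition closed_subspace (H : hilbert) (W : set H) : Prop :=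
  [/\ closed W, W 0 & forall (a : R[i]) v w, W v -> W w -> W (a *: v + w)].

(* rep_continuous is continuity for the strong operator topology. *)
Record unitary_rep (U : metricType R) (H : hilbert) : Type := UnitaryRep {
  rep :> isom U -> {linear H -> H};
  rep_bij : forall g, bijective (rep g);
  rep_dot : forall g v w, hdot H (rep g v) (rep g w) = hdot H v w;
  repM : forall g h v, rep (g * h)%g v = rep g (rep h v);
  rep_continuous : forall v, continuous (fun g => rep g v) }.

Definition irreducible (U : metricType R) (H : hilbert) (pi : unitary_rep U H) :=
  (exists v : H, v != 0) /\
  forall W : set H, closed_subspace W ->
    (forall g v, W v -> W (pi g v)) -> W = [set 0] \/ W = [set: H].

(* The image of J is automatically closed, since J is isometric and H is
   complete. *)
Definition subrep (U : metricType R) (H K : hilbert)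
    (pi : unitary_rep U H) (rho : unitary_rep U K) : Prop :=
  exists J : {linear H -> K},
    (forall v w, hdot K (J v) (J w) = hdot H v w) /\
    (forall g v, J (pi g v) = rho g (J v)).

End Hilbert.

Section EllTwo.
Variables (R : realType) (X : choiceType).

Definition square_summable (f : X -> R[i]^o) : bool :=
  `[< (\esum_(x in [set: X]) (Normc.normc (f x) ^+ 2)%:E < +oo)%E >].

Record ell2 : Type :=
  Ell2 { ell2_fun :> X -> R[i]^o; _ : square_summable ell2_fun }.

HB.instance Definition _ := [isSub for ell2_fun].
HB.instance Definition _ := [Choice of ell2 by <:].

Lemma ell2P (f : ell2) : square_summable f. Proof. by case: f. Qed.

Lemma square_summable_closed :
  GRing.subsemimod_closed (square_summable : {pred X -> R[i]^o}).
Proof.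
have n0 (z : R[i]) : 0 <= Normc.normc z by case: z => a b; exact: sqrtr_ge0.
have scale (c : R) (f : X -> R[i]) : 0 <= c ->
    (\esum_(x in [set: X]) (Normc.normc (f x) ^+ 2)%:E < +oo)%E ->
    (\esum_(x in [set: X]) (c * Normc.normc (f x) ^+ 2)%:E < +oo)%E.
  move=> c0 foo; set S := (X in (X < _)%E) in foo.
  have S0 : (0 <= S)%E by apply: esum_ge0 => x _; rewrite lee_fin exprn_ge0.
  have Sfin : S \is a fin_num by rewrite ge0_fin_numE.
  apply: (@le_lt_trans _ _ (c%:E * S)%E); last first.
    by rewrite -(fineK Sfin) -EFinM ltry.
  rewrite ge_ereal_sup => //= _ [A [finA _]] <-.
  under eq_fsbigr do rewrite EFinM.
  rewrite -ge0_mule_fsumr; last by move=> x; rewrite lee_fin exprn_ge0.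
  rewrite lee_wpmul2l ?lee_fin//; apply: ereal_sup_ubound; exists A => //.
split; first split.
- apply/asboolP; rewrite esum1 // => x _.
  have -> : Normc.normc ((0 : X -> R[i]^o) x) = 0 by exact: Normc.normc0.
  by rewrite expr0n.
- move=> f g /asboolP foo /asboolP goo; apply/asboolP.
  apply: (@le_lt_trans _ _ (\esum_(x in [set: X])
    ((2 * Normc.normc (f x) ^+ 2)%:E + (2 * Normc.normc (g x) ^+ 2)%:E))%E).
    apply: le_esum => x _; rewrite -EFinD lee_fin.
    have := le_normcD (f x) (g x); have := n0 (f x); have := n0 (g x).
    have := n0 (f x + g x).
    have -> : (f + g) x = f x + g x by [].
    move: (Normc.normc (f x + g x)) (Normc.normc (g x)) (Normc.normc (f x)).
    move=> a b c a0 b0 c0 abc.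
    have : a ^+ 2 <= (c + b) ^+ 2 by rewrite ler_sqr ?nnegrE ?addr_ge0.
    have := sqr_ge0 (c - b); rewrite sqrrB sqrrD; lra.
  rewrite esumD; first last.
  - by move=> x _; rewrite lee_fin mulr_ge0// exprn_ge0.
  - by move=> x _; rewrite lee_fin mulr_ge0// exprn_ge0.
  by rewrite lte_add_pinfty ?scale.
move=> a f /asboolP foo; apply/asboolP.
under eq_esum do rewrite Normc.normcM exprMn.
by apply: scale; rewrite ?exprn_ge0.
Qed.

HB.instance Definition _ :=
  GRing.SubChoice_isSubLmodule.Build R[i] (X -> R[i]^o) square_summable ell2
    square_summable_closed.

(* The limit of the sums over finite subsets of X, which exists since the
   terms are absolutely summable. *)
Definition ell2_dot (f g : ell2) : R[i] :=
  summability.sum (fun x : X => f x * conjC (g x) : R[i]^o).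

End EllTwo.

Section Balls.
Variables (R : realType).

Inductive ball_kind := Closed | Open.

Definition mball (U : metricType R) (k : ball_kind) (a : U) (r : \bar R) : set U :=
  match k with
  | Closed => [set x | ((mdist a x)%:E <= r)%E]
  | Open => [set x | ((mdist a x)%:E < r)%E]
  end.

(* The set written with superscript +0: 0 is adjoined unless it is a limit
   point of L. *)
Definition plus0 (L : set R) : set R :=
  [set r | L r \/ r = 0 /\ ~ limit_point L 0].

Definition increasing_limits (L : set R) : set R :=
  [set r | exists u : R^nat,
    [/\ forall n, L (u n), increasing_seq u & u @ \oo --> r]].

Definition perfect_pair (L : set R) (p : ball_kind * \bar R) : Prop :=
  match p with
  | (Closed, r%:E) => plus0 L r
  | (Open, r%:E) => increasing_limits L r
  | (Open, +oo%E) => ~ has_ubound L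
  | _ => False
  end.

Definition Xi (U : metricType R) (p : ball_kind * \bar R) : set (set U) :=
  range (fun x : U => mball p.1 x p.2).
Arguments Xi U p : clear implicits.

Variable U : metricType R.

Lemma isom_mball (g : isom U) k a r : g @` mball k a r = mball k (g a) r.
Proof.
apply/seteqP; split=> [_ [x ax <-]|x ax].
  by move: ax; case: k => /=; rewrite isom_mdist.
exists (g^-1%g x); last exact: isom_invK.
by move: ax; case: k; rewrite /= -{1}(isom_invK g x) isom_mdist.
Qed.

Lemma Xi_act_proof p (g : isom U) (B : Xi U p) : g @` (val B) \in Xi U p.
Proof.
by rewrite inE; have /set_mem[x _ /= <-] := valP B; rewrite isom_mball; exists (g x).
Qed.
Definition Xi_act p (g : isom U) (B : Xi U p) : Xi U p :=
  SigSub (Xi_act_proof g B).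

Lemma Xi_act_bij p (g : isom U) : bijective (@Xi_act p g).
Proof.
exists (@Xi_act p g^-1%g) => B; apply: val_inj; rewrite /= image_comp.
  rewrite (eq_imagel (f' := id)) ?image_id// => x _; exact: isom_funK.
rewrite (eq_imagel (f' := id)) ?image_id// => x _; exact: isom_invK.
Qed.

Definition ell2_Xi p := ell2 R (Xi U p).

Lemma ell2_act_proof p (g : isom U) (f : ell2_Xi p) :
  square_summable (fun B => f (Xi_act g B)).
Proof.
have /asboolP foo := ell2P f; apply/asboolP; rewrite /= in foo *.
rewrite -(@reindex_esum _ _ _ [set: Xi U p] [set: Xi U p] (@Xi_act p g)
  (fun B => (Normc.normc (f B) ^+ 2)%:E)) //.
by rewrite setTT_bijective; exact: Xi_act_bij.
Qed.

(* (g . f) B = f (g^-1 B). *)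
Definition ell2_act p (g : isom U) (f : ell2_Xi p) : ell2_Xi p :=
  Ell2 (ell2_act_proof g^-1%g f).

End Balls.

Section Tensor.
Variable R : realType.

(* The Hilbert tensor product of finitely many inner product spaces is unique
   up to a unique unitary operator compatible with tau, hence it is specified
   here rather than constructed; tau x is the decomposable tensor
   x_0 (x) ... (x) x_(N-1). *)
Record hilbert_tensor (N : nat) (V : 'I_N -> lmodType R[i])
    (dot : forall j, V j -> V j -> R[i])
    (T : hilbert R) (tau : (forall j, V j) -> T) : Prop := HilbertTensor {
  tensor_multilinear : forall (j : 'I_N) (a : R[i]) (x y z : forall i, V i),
    (forall i, i != j -> x i = z i /\ y i = z i) ->
    z j = a *: x j + y j -> tau z = a *: tau x + tau y;
  tensor_dot : forall x y,
    hdot T (tau x) (tau y) = \prod_(j < N) dot j (x j) (y j);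
  tensor_dense : dense [set t : T | exists n (c : 'I_n -> R[i])
      (x : 'I_n -> forall j, V j), t = \sum_(i < n) c i *: tau (x i)] }.

(* rho is the tensor product of the permutation representations; it is
   determined by its values on decomposable tensors. *)
Definition tensor_of_ell2 (U : metricType R) (N : nat)
    (p : 'I_N -> ball_kind * \bar R) (T : hilbert R)
    (tau : (forall j, ell2_Xi U (p j)) -> T) (rho : unitary_rep U T) : Prop :=
  @hilbert_tensor N (fun j => ell2_Xi U (p j)) (fun j => @ell2_dot R _) T tau /\
  forall g x, rho g (tau x) = tau (fun j => ell2_act g (x j)).

End Tensor.

(* Main.v *)
Require Import Defs.
From HB Require Import structures.
From mathcomp Require Import all_boot all_order all_algebra.
From mathcomp Require Import all_classical all_reals all_analysis.
From mathcomp Require Import finmap fingroup perm summability.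
From mathcomp Require Import complex ring lra.

(* For a tuple A of n balls with open stabilizers let H^A be the space of
   vectors of H fixed by the pointwise stabilizer of A. By continuity some H^A
   is nonzero; take n minimal. By homogeneity of the Urysohn space, the
   orthogonal projection to H^A maps H^B into H^(A v B), where A v B consists
   of the smallest balls that contain a ball of A and one of B, and it is a
   tuple of at most n balls. Zorn's lemma then gives a tuple A with H^A
   nonzero whose radii are maximal: if H^A were nonzero along a chain of
   increasing radii but zero at its supremum, then, projections along a chain
   being strongly convergent, irreducibility would give a contradiction. For
   such an A and a nonzero u in H^A, the vectors g u and u are orthogonal
   unless g A is a permutation of A. So the vectors g u, indexed by the tuples
   g A, form a Bessel family in H, and the map that sends v to the function g
   A |-> <v, g u> is a bounded intertwining operator from H to the l2 space of
   tuples of balls, which is the tensor product of the l2 spaces of balls. It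
   is a multiple of an isometry: the Gram matrix of the finitely many vectors
   g u with g A a permutation of A has a nonzero eigenvalue, and H is
   irreducible. *)

Set Implicit Arguments.
Unset Strict Implicit.
Unset Printing Implicit Defensive.

Import Order.TTheory GRing.Theory Num.Def Num.Theory.
Import numFieldNormedType.Exports.

Local Open Scope classical_set_scope.
Local Open Scope ring_scope.
Local Open Scope complex_scope.

(** * Ultrametric spaces and homogeneity *)

(** The stabilizers need not be compact, so the projection to the fixed vectors is obtained as the
    vector of least norm in the closed hull of an orbit. It is a limit of finite averages, and such
    an average only involves the positions of finitely many points, which homogeneity allows to be
    rearranged. Along a chain of increasing radii the centres need not settle; hence only the radii
    are compared, up to one of the finitely many permutations of the indices. A supremum of radii
    need not lie in the spectrum, so the radii are taken to be arbitrary initial segments of the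
    line; perfect pairs enter only at the end, to name the balls that these define. The eigenvalue
    argument is needed because translates of [u] that belong to the same balls in another order need
    not be orthogonal. *)

Section UltrametricSpaces.
Variables (R : realType) (U : metricType R).
Hypothesis U_ultra : ultrametric U.

Lemma ultra_le (y x z : U) (t : R) :
  mdist x y <= t -> mdist y z <= t -> mdist x z <= t.
Proof. by move=> xy yz; apply: le_trans (U_ultra x y z) _;
  rewrite ge_max xy. Qed.

Lemma ultra_lt (y x z : U) (t : R) :
  mdist x y < t -> mdist y z < t -> mdist x z < t.
Proof.
by move=> xy yz; apply: le_lt_trans (U_ultra x y z) _; rewrite gt_max xy.
Qed.

Lemma isosceles (y x z : U) : mdist x y < mdist y z -> mdist x z = mdist y z.
Proof.
move=> xy; apply/eqP; rewrite eq_le; apply/andP; split.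
  by apply: (@ultra_le y) => //; exact: ltW.
rewrite leNgt; apply/negP => xz; suff: mdist y z < mdist y z by rewrite ltxx.
by apply: (@ultra_lt x) => //; rewrite metric_sym.
Qed.

Lemma max_mdist_le (t : R) (a x y : U) :
  mdist x y <= t -> Num.max t (mdist a x) <= Num.max t (mdist a y).
Proof.
move=> xy; rewrite ge_max le_max lexx /=; apply: (@ultra_le y).
  by rewrite le_max lexx orbT.
by rewrite le_max metric_sym xy.
Qed.

(** Truncated at [t], the distance to [a] depends only on the closed ball of radius [t] that
    contains the point; any other point of that ball may serve as the base point. *)
Lemma max_mdist (t : R) (a x y : U) :
  mdist x y <= t -> Num.max t (mdist a x) = Num.max t (mdist a y).
Proof.
move=> xy; apply/eqP; rewrite eq_le !max_mdist_le//.
by rewrite metric_sym.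
Qed.

(* The values [Num.max rho (d a a0)] are the distances to a new point that lies
  at
   distance [rho] from [a0] and as far as possible from everything else. *)
Section OnePointExtension.
Variables (s : seq U) (a0 : U) (rho : R).
Hypothesis rho_gt0 : 0 < rho.

Definition ext_mdist (x y : option (seq_sub s)) : R :=
  match x, y with
  | Some u, Some v => mdist (val u) (val v)
  | Some u, None | None, Some u => Num.max rho (mdist (val u) a0)
  | None, None => 0
  end.

Lemma ext_mdistxx x : ext_mdist x x = 0.
Proof. by case: x => //= u; exact: mdistxx. Qed.

Lemma ext_mdist_sym x y : ext_mdist x y = ext_mdist y x.
Proof. by case: x y => [u|] [v|] //=; exact: metric_sym. Qed.

Lemma ext_mdist_positivity x y : ext_mdist x y = 0 -> x = y.
Proof.
have pos u : 0 < Num.max rho (mdist u a0) by rewrite lt_max rho_gt0.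
case: x y => [u|] [v|] //=.
- by move=> /mdist_positivity/val_inj ->.
- by move=> h; have := pos (val u); rewrite h ltxx.
- by move=> h; have := pos (val v); rewrite h ltxx.
Qed.

Lemma ext_mdist_ultra x y z :
  ext_mdist x z <= Num.max (ext_mdist x y) (ext_mdist y z).
Proof.
have pos u : 0 <= Num.max rho (mdist u a0) by rewrite le_max ltW.
case: x y z => [u|] [v|] [w|] //=.
- rewrite ge_max; apply/andP; split; first by rewrite !le_max lexx ?orbT.
  apply: (@ultra_le (val v)).
    by rewrite !le_max lexx.
  by rewrite !le_max lexx ?orbT.
- apply: (@ultra_le (a0)); first by rewrite !le_max lexx ?orbT.
  by rewrite metric_sym !le_max lexx ?orbT.
- by rewrite le_max lexx.
- rewrite ge_max; apply/andP; split; first by rewrite !le_max lexx ?orbT.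
  apply: (@ultra_le (val v)).
    by rewrite metric_sym !le_max lexx ?orbT.
  by rewrite !le_max lexx ?orbT.
- by rewrite le_max pos.
- by rewrite le_max lexx orbT.
Qed.

Lemma ext_mdist_triangle y x z : ext_mdist x z <= ext_mdist x y + ext_mdist y z.
Proof.
have ge0 u v : 0 <= ext_mdist u v.
  case: u v => [u|] [v|] //=; rewrite ?mdist_ge0//.
    by rewrite le_max ltW.
  by rewrite le_max ltW.
apply: le_trans (ext_mdist_ultra x y z) _.
by rewrite ge_max lerDl lerDr !ge0.
Qed.

End OnePointExtension.
End UltrametricSpaces.

(** * Extension of finite partial isometries to the whole space *)

Section Urysohn.
Variables (R : realType) (L : set R) (U : metricType R).
Hypothesis L_pos : forall r, L r -> 0 < r.
Hypothesis HU : urysohn L U.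
Let U_ultra := urysohn_ultrametric HU.

Lemma mdist_in_spectrum (x y : U) : mdist x y != 0 -> L (mdist x y).
Proof.
move=> xy; rewrite -(urysohn_spectrum HU); exists x, y; split=> //.
by apply: contra_neq xy => ->; exact: mdistxx.
Qed.

Lemma one_point_extension (s : seq U) (a0 : U) (rho : R) : L rho ->
  exists b : U, forall a, a \in s -> mdist b a = Num.max rho (mdist a a0).
Proof.
move=> Lrho; have rho0 := L_pos Lrho.
pose m := isMetric.Build R (option (seq_sub s))
  (@ext_mdistxx _ _ s a0 rho) (@ext_mdist_positivity _ _ s a0 _ rho0)
  (@ext_mdist_sym _ _ s a0 rho) (@ext_mdist_triangle _ _ U_ultra s a0 _ rho0).
pose Y : metricType R := HB.pack (option (seq_sub s)) m.
have dE (x y : option (seq_sub s)) : @mdist R Y x y =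
  ext_mdist a0 rho x y by [].
pose X : set Y := [set y | y != None].
pose f (y : X) : U := if val y is Some u then val (u : seq_sub s) else a0.
have [||||h hd hf] := @urysohn_extension _ _ _ HU Y X f.
- exact: (@finite_finset (option (seq_sub s))).
- exact: ext_mdist_ultra.
- move=> _ [x [y [xy <-]]]; rewrite dE.
  have Lmax u : L (Num.max rho (mdist u a0)).
    case: (leP (mdist u a0) rho) => // ru; apply: mdist_in_spectrum.
    by rewrite gt_eqF// (lt_trans rho0).
  move: x y xy => [u|] [v|] //= xy.
  rewrite -(urysohn_spectrum HU); exists (val u), (val v); split=> //.
- move=> [x xX] [y yX]; rewrite dE /f /=; move: x y xX yX => [u|] [v|] //=.
  by move=> _ /set_mem; rewrite /X/= ?eqxx.
  by move=> /set_mem; rewrite /X/= ?eqxx.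
  by move=> /set_mem; rewrite /X/= ?eqxx.
exists (h None) => a as_.
have aX : Some (SeqSub as_) \in X by apply/mem_set.
have ha : h (Some (SeqSub as_)) = a := hf (SigSub aX).
by rewrite -[in LHS]ha hd dE.
Qed.

Lemma urysohn_inhabited : inhabited U.
Proof.
have unitE (x y : unit) : (0 : R) = 0 -> x = y by case: x y => [] [].
pose m := isMetric.Build R unit (fun _ => erefl) unitE (fun _ _ => erefl)
  (fun _ _ _ => ler_wpDl (lexx 0) (lexx 0)).
pose Y : metricType R := HB.pack unit m.
pose f (y : (set0 : set Y)) : U := False_rect U (set_mem (valP y)).
have [||||h _ _] := @urysohn_extension _ _ _ HU Y set0 f.
- exact: (@finite_finset unit).
- by move=> x y z; rewrite le_max /mdist/= lexx.
- by move=> r [x [y [xy _]]]; case/eqP: xy; case: x y => [] [].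
- by move=> x; case: (set_mem (valP x)).
by constructor; exact: (h tt).
Qed.

Lemma seq_argmin (T : eqType) (f : T -> R) (s : seq T) (x : T) : x \in s ->
  exists2 y, y \in s & forall z, z \in s -> f y <= f z.
Proof.
elim: s x => // a s IH x _; have [->|[b bs]] : s = [::] \/ exists b, b \in s.
  by case: (s) => [|b s']; [left|right; exists b; rewrite mem_head].
  by exists a => [|z]; rewrite inE// => /eqP ->.
have [y ys ymin] := IH b bs.
case: (leP (f a) (f y)) => [ay|/ltW ya].
  exists a => [|z]; first exact: mem_head.
  by rewrite inE => /predU1P[->//|/ymin]; exact: le_trans.
exists y => [|z]; first by rewrite inE ys orbT.
by rewrite inE => /predU1P[->//|/ymin].
Qed.

(** A nearest point [a0] determines the distances of [q] to all the points of a finite set: they are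
    those of the generic point at distance [mdist q a0] from [a0]. Extending a finite isometry by
    one point thus reduces to [one_point_extension]. *)
Lemma nearest_mdist (q a a0 : U) : mdist q a0 <= mdist q a ->
  Num.max (mdist q a0) (mdist a a0) = mdist q a.
Proof.
have -> : Num.max (mdist q a0) (mdist a a0) = Num.max (mdist q a0) (mdist a q).
  by apply: (max_mdist U_ultra); rewrite metric_sym.
by rewrite (metric_sym a); apply/max_idPr.
Qed.

Definition partial_isometry (l : seq (U * U)) : Prop :=
  forall p q, p \in l -> q \in l -> mdist p.1 q.1 = mdist p.2 q.2.

Lemma partial_isometry_cons (l : seq (U * U)) (a b : U) :
  partial_isometry l -> (forall p, p \in l -> mdist a p.1 = mdist b p.2) ->
  partial_isometry ((a, b) :: l).
Proof.
move=> lP ab p q; rewrite !inE => /predU1P[->|pl] /predU1P[->|ql].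
- by rewrite !mdistxx.
- exact: ab.
- by rewrite metric_sym ab// metric_sym.
- exact: lP.
Qed.

Lemma partial_isometry_extend (l : seq (U * U)) (a : U) : partial_isometry l ->
  exists b, partial_isometry ((a, b) :: l).
Proof.
move=> lP; have [l0|[p0 p0l p0min]] : l = [::] \/
    exists2 p0, p0 \in l & forall p, p \in l -> mdist a p0.1 <= mdist a p.1.
  case: (l) => [|p l']; [by left|right].
  by apply: (@seq_argmin _ (fun p => mdist a p.1)) (mem_head p l').
  by exists a; rewrite l0; apply: partial_isometry_cons.
have [a0|a0] := eqVneq (mdist a p0.1) 0.
  exists p0.2; apply: partial_isometry_cons => // p pl.
  by rewrite (mdist_positivity _ _ a0); exact: lP.
have [b bP] := one_point_extension [seq p.2 | p <- l] p0.2 (mdist_in_spectrum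
  a0).
exists b; apply: partial_isometry_cons => // p pl.
rewrite (bP p.2) ?map_f// -(lP p p0)//; symmetry; exact/nearest_mdist/p0min.
Qed.

Lemma partial_isometry_swap (l : seq (U * U)) :
  partial_isometry l -> partial_isometry [seq (p.2, p.1) | p <- l].
Proof.
by move=> lP _ _ /mapP[p pl ->] /mapP[q ql ->] /=; rewrite (lP p q).
Qed.

Lemma partial_isometry_back (l : seq (U * U)) (b : U) : partial_isometry l ->
  exists a, partial_isometry ((a, b) :: l).
Proof.
move=> /partial_isometry_swap/(partial_isometry_extend b)[a]
  /partial_isometry_swap.
by rewrite /= mapK; [exists a|case].
Qed.

Definition isometric_rel (S : U -> U -> Prop) : Prop :=
  forall a b a' b', S a b -> S a' b' -> mdist a a' = mdist b b'.

(** Completeness provides [y] as the limit of the partners of points approaching [x]. Its distances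
    are exact because a nonzero ultrametric distance does not change when an endpoint moves by less
    than that distance. *)
Lemma isometric_rel_extend (S : U -> U -> Prop) : isometric_rel S ->
  (forall x (e : R), 0 < e -> exists a b, S a b /\ mdist x a < e) ->
  forall x, exists y, forall a b, S a b -> mdist y b = mdist x a.
Proof.
move=> SP Sdense x.
pose F : set_system U := filter_from [set e : R | 0 < e]
  (fun e => [set b | exists2 a, S a b & mdist x a < e]).
have FF : ProperFilter F.
  apply: filter_from_proper; last first.
    by move=> e /(Sdense x)[a [b [ab xa]]]; exists b, a.
  apply: filter_from_filter; first by exists 1; rewrite /= ltr01.
  move=> e e' /= e0 e'0; exists (Num.min e e'); first by rewrite /= lt_min e0.
  by move=> b [a ab]; rewrite lt_min => /andP[]; split; exists a.
have Fc : cauchy F.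
  apply: cauchy_exP => e e0; have [a [b [ab xa]]] := Sdense x e e0.
  exists b; exists e => // b' [a' ab' xa'].
  rewrite ballEmdist /= -(SP _ _ _ _ ab ab').
  by apply: (ultra_lt U_ultra) xa'; rewrite metric_sym.
have [y Fy] := urysohn_complete HU FF Fc.
have near e : 0 < e -> exists a b, [/\ S a b, mdist x a < e & mdist y b < e].
  move=> e0; have : F (ball y e) by apply: Fy; exact: nbhsx_ballx.
  move=> [d d0 dy]; have [|a [b [ab xa]]] := Sdense x (Num.min d e).
    by rewrite lt_min e0 andbT.
  exists a, b; move: xa; rewrite lt_min => /andP[xad xae]; split=> //.
  have : ball y e b by apply: dy; exists a.
  by rewrite ballEmdist.
exists y => a b ab; have [xa|xa] := eqVneq (mdist x a) 0.
  rewrite xa; apply/eqP; rewrite eq_le mdist_ge0 andbT.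
  apply/ler_addgt0Pr => e /near[a' [b' [ab' xa' yb']]]; rewrite add0r ltW//.
  apply: (ultra_lt U_ultra) yb' _; rewrite -(SP _ _ _ _ ab' ab) metric_sym.
  by rewrite -(mdist_positivity _ _ xa).
have xa0 : 0 < mdist x a by rewrite lt_neqAle eq_sym xa mdist_ge0.
have [a' [b' [ab' xa' yb']]] := near _ xa0.
have e1 : mdist a' a = mdist x a.
  by apply: (isosceles U_ultra); rewrite metric_sym.
rewrite -e1 (SP _ _ _ _ ab' ab); apply: (isosceles U_ultra).
by rewrite -(SP _ _ _ _ ab' ab) e1.
Qed.

Lemma isometric_rel_isom (S : U -> U -> Prop) : isometric_rel S ->
  (forall x (e : R), 0 < e -> exists a b, S a b /\ mdist x a < e) ->
  (forall y (e : R), 0 < e -> exists a b, S a b /\ mdist y b < e) ->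
  exists g : isom U, forall a b, S a b -> g a = b.
Proof.
move=> SP Sdom Sran.
have /choice[f fP] := isometric_rel_extend SP Sdom.
(* The transposed relation satisfies the same hypotheses and yields the inverse map. *)
have [||f' f'P] := choice (@isometric_rel_extend (fun b a => S a b) _ _).
- by move=> b a b' a' ab ab'; rewrite (SP _ _ _ _ ab ab').
- by move=> y e /(Sran y)[a [b ?]]; exists b, a.
have eq0 (x y : U) : (forall e : R, 0 < e -> mdist x y < e) -> x = y.
  move=> xy; apply: mdist_positivity; apply/eqP; rewrite eq_le mdist_ge0 andbT.
  by apply/ler_addgt0Pr => e /xy; rewrite add0r => /ltW.
have fK : cancel f f'.
  move=> x; apply: eq0 => e /(Sdom x)[a [b [ab xa]]].
  apply: (ultra_lt U_ultra (y := a)); last by rewrite metric_sym.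
  by rewrite (f'P _ _ _ ab) (fP _ _ _ ab).
have f'K : cancel f' f.
  move=> y; apply: eq0 => e /(Sran y)[a [b [ab yb]]].
  apply: (ultra_lt U_ultra (y := b)); last by rewrite metric_sym.
  by rewrite (fP _ _ _ ab) (f'P _ _ _ ab).
have fiso x x' : mdist (f x) (f x') = mdist x x'.
  have [->|xx'] := eqVneq x x'; first by rewrite !mdistxx.
  have /(Sdom x)[a [b [ab xa]]] : 0 < mdist x x' by rewrite mdist_gt0.
  have e1 : mdist a x' = mdist x x'.
    by apply: (isosceles U_ultra); rewrite metric_sym.
  have e2 : mdist b (f x') = mdist x x' by rewrite metric_sym (fP x' _ _ ab)
    metric_sym.
  rewrite -e2; apply: (isosceles U_ultra).
  by rewrite (fP x _ _ ab) e2.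
have giso : is_isometry f by apply/asboolP; split=> //; exists f'.
exists (Isom giso) => a b ab; apply: mdist_positivity.
by rewrite /= (fP a _ _ ab) mdistxx.
Qed.

Lemma dense_sequence : exists e : nat -> U, forall x (r : R), 0 < r ->
  exists n, mdist x (e n) < r.
Proof.
have [x0] := urysohn_inhabited.
have [D /countable_injP[f finj] Ddense] := urysohn_separable HU.
exists (fun n => xget x0 [set x | D x /\ f x = n]) => x r r0.
have /Ddense[|y [xy Dy]] : (ball x r)^° !=set0; last first.
- exists (f y); have -> : xget x0 [set z | D z /\ f z = f y] = y.
    apply: xget_subset1; first by split.
    move=> z z' [Dz fz] [Dz' fz']; apply: finj; rewrite ?fz ?fz'//.
      exact/mem_set.
    exact/mem_set.
  by have /interior_subset := xy; rewrite ballEmdist.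
- exact: open_interior.
- by exists x; exact: nbhsx_ballx.
Qed.

(** Back and forth along a dense sequence: the union of the finite stages is an isometric relation
    with dense domain and dense range. *)
Lemma partial_isometry_isom (l : seq (U * U)) : partial_isometry l ->
  exists g : isom U, forall p, p \in l -> g p.1 = p.2.
Proof.
move=> lP; have [e eD] := dense_sequence.
pose T := {k : seq (U * U) | partial_isometry k}.
have step (kn : T * nat) : exists k' : T,
    [/\ {subset sval kn.1 <= sval k'}, exists b, (e kn.2, b) \in sval k'
      & exists a, (a, e kn.2) \in sval k'].
  case: kn => [[k kP] n].
  have [b bP] := partial_isometry_extend (e n) kP.
  have [a aP] := partial_isometry_back (e n) bP.
  exists (exist _ _ aP); split=> /=.
  - by move=> p pk; rewrite !inE pk !orbT.
  - by exists b; rewrite !inE eqxx orbT.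
  - by exists a; rewrite inE eqxx.
have {step}[st stP] := choice step.
pose ls := fix ls n : T := if n is m.+1 then st (ls m, m) else exist _ l lP.
have ls_le m n : (m <= n)%N -> {subset sval (ls m) <= sval (ls n)}.
  elim: n => [|n IH]; first by rewrite leqn0 => /eqP ->.
  rewrite leq_eqVlt ltnS => /predU1P[->//|/IH mn] p /mn pn.
  by have [+ _ _] := stP (ls n, n); exact.
have [|||g gP] := @isometric_rel_isom (fun a b => exists n, (a,
  b) \in sval (ls n)).
- move=> a b a' b' [n an] [m am].
  have nP := svalP (ls (maxn n m)).
  by apply: (nP (a, b) (a', b')); [apply: ls_le an|apply: ls_le am];
    rewrite ?leq_maxl ?leq_maxr.
- move=> x r /(eD x)[n xn]; have [_ [b bP] _] := stP (ls n, n).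
  by exists (e n), b; split=> //; exists n.+1.
- move=> x r /(eD x)[n xn]; have [_ _ [a aP]] := stP (ls n, n).
  by exists a, (e n); split=> //; exists n.+1.
by exists g => -[a b] ab; apply: gP; exists 0%N.
Qed.
End Urysohn.

(** * Displacement into general position *)

Section Displacement.
Variables (R : realType) (L : set R) (U : metricType R).
Hypothesis L_pos : forall r, L r -> 0 < r.
Hypothesis HU : urysohn L U.
Let U_ultra := urysohn_ultrametric HU.

(* A ball is encoded by a center [x] and a cut [D], as the set of all [y] with
   [D (mdist x y)]. This treats closed balls, open balls and the whole space
   uniformly; a positive element of [D] makes the stabilizer of the ball open.
     *)
Definition cut (D : set R) : Prop :=
  (forall s t, s <= t -> D t -> D s) /\ exists2 e, 0 < e & D e.

Lemma cut_le (D : set R) s t : cut D -> s <= t -> D t -> D s.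
Proof. by move=> [Dle _]; exact: Dle. Qed.

Lemma cut0 (D : set R) : cut D -> D 0.
Proof. by move=> [Dle [e e0 De]]; apply: (Dle _ e) => //; exact: ltW. Qed.

Lemma cut_lt (D : set R) s t : cut D -> D s -> ~ D t -> s < t.
Proof.
by move=> cD Ds Dt; rewrite ltNge; apply/negP => ts; apply/Dt/(cut_le cD ts).
Qed.

Lemma cut_mdist (D : set R) (y x z : U) : cut D ->
  D (mdist x y) -> D (mdist y z) -> D (mdist x z).
Proof.
move=> cD Dxy Dyz; apply: cut_le (U_ultra x y z) _ => //.
by case: leP.
Qed.

(** Since [q] and its image [w] lie in one closed ball of radius [rho], the generic point at
    distance [rho] from [q] is equally far from [p.1] and [p.2]. It can therefore be declared a
    fixed point of the partial isometry. *)
Lemma generic_point (l : seq (U * U)) (q w : U) (rho : R) :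
  partial_isometry l -> (q, w) \in l -> L rho -> mdist q w <= rho ->
  exists2 b, (forall p, p \in l -> mdist b p.1 = Num.max rho (mdist p.1 q))
           & partial_isometry ((b, b) :: l).
Proof.
move=> lP ql Lrho qw.
have [b bP] := one_point_extension L_pos HU
  ([seq p.1 | p <- l] ++ [seq p.2 | p <- l]) q Lrho.
exists b => [p pl|]; first by rewrite bP// mem_cat map_f.
apply: partial_isometry_cons => // p pl.
rewrite !bP ?mem_cat ?map_f ?orbT// (max_mdist U_ultra p.2 qw).
by rewrite (lP p (q, w)).
Qed.

Variables (n : nat) (x : 'I_n -> U) (D : 'I_n -> set R).
Hypothesis cutD : forall i, cut (D i).
Hypothesis disjD : forall i j, i != j -> ~ D i (mdist (x i) (x j)).

Definition pointwise_stab : set (isom U) :=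
  [set g | forall i, D i (mdist (x i) (g (x i)))].

Variable h : isom U.

(* The possible displacements [delta] of a point in general position relative
   to the balls, at the same distances from them as [p]. *)
Definition forced (p : U) (delta : R) : Prop :=
  delta = 0 \/ exists i, [/\ delta = mdist (x i) (h (x i)), ~ D i delta
                           & mdist p (x i) < delta].

(** [lg] and [lh] are finite parts of the isometries [g] and [h'] of [general_position]. A centre
    that [h] moves within its ball is sent by [lg] to a generic point of that ball, which [lh] may
    fix. A centre that [h] fixes or moves out of its ball stays where it is, and its displacement is
    forced. *)
Lemma place_centers (F : seq U) (s : seq 'I_n) :
  (forall i, x i \in F) ->
  exists lg lh : seq (U * U),
    [/\ partial_isometry lg, partial_isometry lh,
        forall f, f \in F -> (f, h f) \in lh,
        forall i, i \in s -> exists2 x', (x i, x') \in lg & D i (mdist (x i) x')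
      & forall q, q \in lg -> [/\ exists2 i,
        i \in s & q.1 = x i /\ D i (mdist (x i) q.2) &
          exists2 w, (q.2, w) \in lh & forced q.1 (mdist q.2 w)]].
Proof.
move=> xF; elim: s => [|i s [lg [lh [lgP lhP hlh sg gh]]]].
  exists [::], [seq (f, h f) | f <- F]; split=> //.
    by move=> _ _ /mapP[p _ ->] /mapP[q _ ->] /=; rewrite isom_mdist.
  by move=> f fF; apply/mapP; exists f.
have [is_|is_] := boolP (i \in s).
  exists lg, lh; split=> //.
    by move=> j; rewrite inE => /predU1P[->|]; exact: sg.
  by move=> q /gh[[j js qj] ?]; split=> //; exists j; rewrite ?inE ?js ?orbT.
suff [x' [k [kP klh Dx' xk]]] : exists x' k, [/\ partial_isometry k,
    {subset lh <= k}, D i (mdist (x i) x')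
    & exists2 w, (x', w) \in k & forced (x i) (mdist x' w)].
  exists ((x i, x') :: lg), k; split=> //.
  (* The balls are disjoint, so the distance between points of two of them is the distance of the
     centres; each centre may move in its ball regardless of the others. *)
  - apply: partial_isometry_cons => // q /gh[[j js [-> Dq]] _].
    have ij : i != j by apply: contraNneq is_ => ->.
    have xx' : mdist x' (x i) < mdist (x i) (x j).
      by rewrite metric_sym; apply: cut_lt Dx' (disjD ij).
    have xq : mdist q.2 (x j) < mdist (x j) (x i).
      by rewrite metric_sym; apply: cut_lt Dq (disjD _); rewrite // eq_sym.
    have x'j := isosceles U_ultra xx'; rewrite -x'j.
    rewrite (metric_sym x' q.2) (metric_sym x'); symmetry.
    by apply: (isosceles U_ultra); rewrite (metric_sym _ x') x'j (metric_sym (x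
      i)).
  - by move=> f /hlh; exact: klh.
  - move=> j; rewrite inE => /predU1P[->|/sg[y yg Dy]].
      by exists x'; rewrite ?mem_head.
    by exists y; rewrite // inE yg orbT.
  - move=> q; rewrite inE => /predU1P[->/=|/gh[[j js qj] [w wl wf]]].
      by split=> //; exists i; rewrite ?mem_head.
    split; first by exists j; rewrite // inE js orbT.
    by exists w => //; exact: klh.
have [xi0|xi0] := eqVneq (mdist (x i) (h (x i))) 0.
  exists (x i), lh; split=> //; first by rewrite mdistxx; exact: cut0.
  by exists (h (x i)); [exact: hlh|left].
have [Di|Di] := pselect (D i (mdist (x i) (h (x i)))); last first.
  exists (x i), lh; split=> //; first by rewrite mdistxx; exact: cut0.
  exists (h (x i)); [exact: hlh|right]; exists i; split=> //.
  by rewrite mdistxx lt_neqAle eq_sym xi0 mdist_ge0.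
have [b bP bl] :=
  generic_point lhP (hlh _ (xF i)) (mdist_in_spectrum HU xi0) (lexx _).
exists b, ((b, b) :: lh); split=> //.
- by move=> p pl; rewrite inE pl orbT.
- rewrite metric_sym (bP (x i, h (x i))) ?hlh//= mdistxx.
  by rewrite (max_idPl _) // mdist_ge0.
- by exists b; rewrite ?mem_head//; left; rewrite mdistxx.
Qed.

(** A point [p] of [P] is placed by means of the nearest point [q.1] in the domain of [lg], which is
    nonempty as [0 < n]. If [lh] moves [q.2] by at most the distance from [p] to [q.1], then [p] can
    go to a generic point that is declared fixed. Otherwise the image of [p] is so close to [q.2]
    that it is displaced by the same amount, and a forced displacement remains forced for [p]. *)
Lemma general_position (F P : seq U) : (0 < n)%N ->
  exists g h' : isom U, [/\ pointwise_stab g, forall f, f \in F -> h' f = h f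
    & forall p, p \in P -> forced p (mdist (g p) (h' (g p)))].
Proof.
move=> n0; pose i0 := Ordinal n0.
suff [lg [lh [lgP lhP hlh xg gP]]] : exists lg lh : seq (U * U),
    [/\ partial_isometry lg, partial_isometry lh,
        forall f, f \in F -> (f, h f) \in lh,
        forall i, exists2 x', (x i, x') \in lg & D i (mdist (x i) x')
      & forall p, p \in P -> exists2 p', (p, p') \in lg &
          exists2 w, (p', w) \in lh & forced p (mdist p' w)].
  have [g gl] := partial_isometry_isom L_pos HU lgP.
  have [h' hl] := partial_isometry_isom L_pos HU lhP.
  exists g, h'; split.
  - by move=> i; have [x' /gl /= ->] := xg i.
  - by move=> f /hlh/hl.
  - by move=> p /gP[p' /gl /= -> [w /hl /= ->]].
have [|lg0 [lh0 [lgP lhP hlh xg gh]]] :=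
    @place_centers (F ++ codom x) (enum 'I_n).
  by move=> i; rewrite mem_cat codom_f orbT.
suff [lg [lh [? ? hh0 gg0 [Pg gl]]]] : exists lg lh : seq (U * U),
    [/\ partial_isometry lg, partial_isometry lh, {subset lh0 <= lh},
      {subset lg0 <= lg} &
      (forall p, p \in P -> exists p', (p, p') \in lg) /\
      (forall q, q \in lg -> exists2 w, (q.2,
        w) \in lh & forced q.1 (mdist q.2 w))].
  exists lg, lh; split=> //.
  - by move=> f fF; apply: hh0; apply: hlh; rewrite mem_cat fF.
  - move=> i; have [|x' x'g Dx'] := xg i; first by rewrite mem_enum.
    by exists x' => //; exact: gg0.
  - move=> p /Pg[p' pp']; exists p' => //.
    exact: (gl (p, p')).
elim: P => [|p P [lg [lh [gP hP hh0 gg0 [Pg gl]]]]].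
  by exists lg0, lh0; split=> //; split=> // q /gh[].
have [[p' pp']|np] := pselect (exists p', (p, p') \in lg).
  exists lg, lh; split=> //; split=> // q; rewrite inE => /predU1P[->|/Pg//].
  by exists p'.
suff [p' [k [gk kP klh [w wk fw]]]] : exists p' k,
    [/\ partial_isometry ((p, p') :: lg), partial_isometry k, {subset lh <= k}
      & exists2 w, (p', w) \in k & forced p (mdist p' w)].
  exists ((p, p') :: lg), k; split=> //.
  - by move=> q /hh0/klh.
  - by move=> q /gg0; rewrite inE orbC => ->.
  split=> q; rewrite inE => /predU1P[->|].
  - by exists p'; rewrite mem_head.
  - by move=> /Pg[q' qq']; exists q'; rewrite inE qq' orbT.
  - by exists w.
  - by move=> /gl[v vl fv]; exists v => //; exact: klh.
have [|x0 x0g _] := xg i0; first by rewrite mem_enum.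
have [q qg qmin] := seq_argmin (fun q => mdist p q.1) (gg0 _ x0g).
have pq : mdist p q.1 != 0.
  apply/negP => /eqP/mdist_positivity pq; apply: np; exists q.2.
  by rewrite pq -surjective_pairing.
have [w wl fw] := gl _ qg.
have [qw|qw] := leP (mdist q.2 w) (mdist p q.1).
  have [b bP bk] := generic_point hP wl (mdist_in_spectrum HU pq) qw.
  exists b, ((b, b) :: lh); split=> //.
  - apply: partial_isometry_cons => // r rg.
    have [v vl _] := gl _ rg.
    by rewrite (bP _ vl) /= -(gP r q)// (nearest_mdist HU)// qmin.
  - by move=> r rl; rewrite inE rl orbT.
  - by exists b; rewrite ?mem_head//; left; rewrite mdistxx.
have [p' p'P] := partial_isometry_extend L_pos HU p gP.
have [v vP] := partial_isometry_extend L_pos HU p' hP.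
exists p', ((p', v) :: lh); split=> //.
  by move=> r rl; rewrite inE rl orbT.
exists v; first by rewrite mem_head.
have p'q : mdist p' q.2 = mdist p q.1.
  by symmetry; apply: (p'P (p, p') q); rewrite inE ?eqxx ?qg ?orbT.
have vw : mdist v w = mdist p q.1.
  by rewrite -p'q; symmetry; apply: (vP (p', v) (q.2, w));
    rewrite inE ?eqxx ?wl ?orbT.
have p'w : mdist p' w = mdist q.2 w by apply: (isosceles U_ultra); rewrite p'q.
have -> : mdist p' v = mdist q.2 w.
  rewrite metric_sym -p'w (metric_sym p'); apply: (isosceles U_ultra).
  by rewrite vw (metric_sym w) p'w.
case: fw => [qw0|[i [qi Di iq]]].
  by move: qw; rewrite qw0 ltNge mdist_ge0.
right; exists i; split=> //.
by apply: (ultra_lt U_ultra) iq.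
Qed.

End Displacement.

(** * Hilbert spaces *)

Section HilbertGeometry.
Variables (R : realType) (H : hilbert R).
Implicit Types u v w : H.
Implicit Types a : R[i].

Definition dot u v : R[i] := hdot H u v.

Lemma dotDl u v w : dot (u + v) w = dot u w + dot v w.
Proof. exact: linearDl. Qed.

Lemma dotDr u v w : dot u (v + w) = dot u v + dot u w.
Proof. exact: linearDr. Qed.

Lemma dotZl a u v : dot (a *: u) v = a * dot u v.
Proof. by rewrite /dot linearZl_LR. Qed.

Lemma dotZr a u v : dot u (a *: v) = conjC a * dot u v.
Proof. by rewrite /dot linearZr_LR. Qed.

Lemma dotC u v : dot u v = conjC (dot v u).
Proof. by rewrite /dot hermC /= expr0 mul1r. Qed.

Lemma dotNl u v : dot (- u) v = - dot u v.
Proof. exact: linearNl. Qed.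

Lemma dotNr u v : dot u (- v) = - dot u v.
Proof. exact: linearNr. Qed.

Lemma dotBl u v w : dot (u - v) w = dot u w - dot v w.
Proof. exact: linearBl. Qed.

Lemma dotBr u v w : dot u (v - w) = dot u v - dot u w.
Proof. exact: linearBr. Qed.

Lemma dot0l u : dot 0 u = 0.
Proof. exact: linear0l. Qed.

Lemma dot0r u : dot u 0 = 0.
Proof. exact: linear0r. Qed.

(** The norm of [H] has values in [R[i]]; its real part allows the use of real-field arithmetic. *)
Definition nrm v : R := complex.Re `|v|.

Lemma nrmE v : `|v| = (nrm v)%:C.
Proof. by rewrite /nrm RRe_real// normr_real. Qed.

Lemma nrm_ge0 v : 0 <= nrm v.
Proof. by rewrite -lecR -nrmE normr_ge0. Qed.

Lemma nrm0 : nrm 0 = 0.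
Proof. by rewrite /nrm normr0. Qed.

Lemma nrm_eq0 v : (nrm v == 0) = (v == 0).
Proof. by rewrite -(inj_eq (@complexI R)) -nrmE normr_eq0. Qed.

Lemma nrm_gt0 v : (0 < nrm v) = (v != 0).
Proof. by rewrite lt_neqAle nrm_ge0 andbT eq_sym nrm_eq0. Qed.

Lemma nrmD u v : nrm (u + v) <= nrm u + nrm v.
Proof. by rewrite -lecR rmorphD /= -!nrmE ler_normD. Qed.

Lemma nrmN v : nrm (- v) = nrm v.
Proof. by rewrite /nrm normrN. Qed.

Lemma nrmB u v : nrm (u - v) = nrm (v - u).
Proof. by rewrite -nrmN opprB. Qed.

Lemma nrm_dist w u v : nrm (u - v) <= nrm (u - w) + nrm (w - v).
Proof. by rewrite -[u - v](subrKA w) nrmD. Qed.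

Lemma dotvv v : dot v v = (nrm v ^+ 2)%:C.
Proof. by rewrite /dot hdot_norm nrmE rmorphXn. Qed.

Lemma nrm_eq u v : dot u u = dot v v -> nrm u = nrm v.
Proof.
rewrite !dotvv => /complexI/eqP; rewrite eqrXn2 ?nrm_ge0//.
by move/eqP.
Qed.

Lemma normc_ge0 (z : R[i]) : 0 <= Normc.normc z.
Proof. by case: z => x y; exact: sqrtr_ge0. Qed.

Lemma normcE (z : R[i]) : `|z| = (Normc.normc z)%:C.
Proof. by case: z. Qed.

Lemma cauchy_schwarz u v : Normc.normc (dot u v) <= nrm u * nrm v.
Proof.
have [->|v0] := eqVneq v 0; first by rewrite dot0r Normc.normc0 nrm0 mulr0.
rewrite -(@ler_pXn2r _ 2) ?nnegrE ?mulr_ge0 ?normc_ge0 ?nrm_ge0//.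
rewrite -lecR rmorphXn /= -normcE exprMn rmorphM /= -!dotvv.
have vv : 0 < dot v v by rewrite dotvv ltcR exprn_gt0// nrm_gt0.
(* The component of [u] orthogonal to [v], multiplied by [dot v v] to avoid a division. *)
have : 0 <= dot (dot v v *: u - dot u v *: v) (dot v v *: u - dot u v *: v).
  by rewrite dotvv ler0c exprn_ge0// nrm_ge0.
have cvv : conjC (dot v v) = dot v v by rewrite -dotC.
rewrite !(dotBl, dotBr, dotZl, dotZr) cvv -(dotC v u).
rewrite normCK -(dotC v u).
have -> : dot v v * (dot v v * dot u u - dot v u * dot u v) -
  dot u v * (dot v v * dot v u - dot v u * dot v v) =
  dot v v * (dot u u * dot v v - dot u v * dot v u) by ring.
by rewrite pmulr_rge0// subr_ge0.
Qed.

Lemma parallelogram u v :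
  nrm (u + v) ^+ 2 + nrm (u - v) ^+ 2 = 2 * nrm u ^+ 2 + 2 * nrm v ^+ 2.
Proof.
apply/complexI; transitivity (dot (u + v) (u + v) + dot (u - v) (u - v)).
  by rewrite !dotvv rmorphD.
transitivity (2 * dot u u + 2 * dot v v).
  by rewrite !(dotDl, dotDr, dotNl, dotNr); ring.
by rewrite !dotvv rmorphD /= !mulr_natl !rmorphMn.
Qed.

Lemma pythagoras u v : dot u v = 0 -> nrm (u + v) ^+ 2 =
  nrm u ^+ 2 + nrm v ^+ 2.
Proof.
move=> uv; apply/complexI; rewrite [RHS]rmorphD /= -!dotvv !(dotDl,
  dotDr) uv (dotC v).
by rewrite uv conjC0 addr0 add0r.
Qed.

Lemma dot_small u v (c : R) :
  (forall e : R, 0 < e -> Normc.normc (dot u v) <= e * c) -> dot u v = 0.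
Proof.
move=> uv; apply: Normc.eq0_normc; apply/eqP; rewrite eq_le normc_ge0 andbT.
have [c0|c0] := leP c 0.
  by apply: le_trans (uv 1 ltr01) _; rewrite mul1r.
apply/ler_addgt0Pr => e e0; rewrite add0r.
by apply: le_trans (uv (e / c) _) _; rewrite ?divr_gt0// divfK// gt_eqF.
Qed.

Lemma ballC (v w : H) (e : R) : ball v e%:C w <-> nrm (v - w) < e.
Proof. by rewrite -ball_normE /= nrmE ltcR. Qed.

Lemma gt0C (e : R[i]) : 0 < e -> exists2 r : R, 0 < r & e = r%:C.
Proof.
by move=> e0; exists (complex.Re e); rewrite ?RRe_real ?gtr0_real// -ltcR
  RRe_real ?gtr0_real.
Qed.

End HilbertGeometry.

(** * Vectors fixed by a group *)

Section FixedVectors.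
Variables (R : realType) (U : metricType R) (H : hilbert R).
Variable pi : unitary_rep U H.
Implicit Types (g h : isom U) (u v w : H) (K : set (isom U)).

Lemma rep_nrm g v : nrm (pi g v) = nrm v.
Proof. by apply: nrm_eq; exact: rep_dot. Qed.

Lemma rep1 v : pi 1%g v = v.
Proof. by apply: (bij_inj (rep_bij pi 1%g)); rewrite -repM mul1g. Qed.

Lemma repV g v : pi g^-1%g (pi g v) = v.
Proof. by rewrite -repM mulVg rep1. Qed.

Definition fixed K v : Prop := forall g, K g -> pi g v = v.

(** The averages of the orbit of [v] with dyadic weights. As an inductive predicate, they make
    invariance, finiteness and norm bounds plain inductions. *)
Inductive hull K v : H -> Prop :=
| hull_rep g : K g -> hull K v (pi g v)
| hull_mid a b : hull K v a -> hull K v b -> hull K v (2^-1 *: (a + b)).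

Lemma half_nrm v : nrm (2^-1 *: v) = nrm v / 2.
Proof.
apply/complexI; rewrite -nrmE normrZ ger0_norm ?invr_ge0 ?ler0n//.
by rewrite nrmE mulrC rmorphM /= fmorphV rmorph_nat.
Qed.

Lemma halfD v : 2^-1 *: (v + v) = v.
Proof. by rewrite scalerDr -scalerDl -[2^-1]mul1r -splitr scale1r. Qed.

Lemma fixed_dot K u v g : fixed K u -> K g -> dot (pi g v) u = dot v u.
Proof. by move=> uK gK; rewrite -{1}(uK g gK); exact: rep_dot. Qed.

Lemma hull_dot K u v a : fixed K u -> hull K v a -> dot a u = dot v u.
Proof.
move=> uK; elim => [g|a1 a2 _ h1 _ h2]; first exact: fixed_dot.
by rewrite dotZl dotDl h1 h2 -dotDl -dotZl halfD.
Qed.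

Lemma hull_sub K K' v a : K `<=` K' -> hull K v a -> hull K' v a.
Proof.
by move=> KK'; elim => [g /KK'|a1 a2 _ h1 _ h2];
  [exact: hull_rep|exact: hull_mid].
Qed.

Lemma hull_finite K v a : hull K v a -> exists s : seq (isom U),
  (forall g, g \in s -> K g) /\ hull [set` s] v a.
Proof.
elim => [g Kg|a1 a2 _ [s1 [s1K h1]] _ [s2 [s2K h2]]].
  exists [:: g]; split; first by move=> g'; rewrite inE => /eqP ->.
  by apply: hull_rep; rewrite /= mem_head.
exists (s1 ++ s2); split.
  by move=> g; rewrite mem_cat => /orP[/s1K|/s2K].
apply: hull_mid.
  by apply: hull_sub h1 => g /= gs; rewrite mem_cat gs.
by apply: hull_sub h2 => g /= gs; rewrite mem_cat gs orbT.
Qed.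

Lemma hull_close v w a (e : R) K : (forall g, K g -> nrm (pi g v - w) <= e) ->
  hull K v a -> nrm (a - w) <= e.
Proof.
move=> Ke; elim => [g|a1 a2 _ h1 _ h2]; first exact: Ke.
rewrite -[w]halfD -scalerBr half_nrm opprD addrACA ler_pdivrMr//.
by apply: le_trans (nrmD _ _) _; rewrite mulr_natr mulr2n lerD.
Qed.

Definition subgroup K : Prop :=
  [/\ K 1%g, forall g h, K g -> K h -> K (g * h)%g & forall g, K g -> K g^-1%g].

Lemma hull_act K v a g : subgroup K -> K g -> hull K v a -> hull K v (pi g a).
Proof.
move=> [_ KM _] Kg; elim => [h Kh|a1 a2 _ h1 _ h2].
  by rewrite -repM; apply: hull_rep; exact: KM.
by rewrite linearZ linearD; exact: hull_mid.
Qed.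

(* [w] is the vector of minimal norm in the closed convex hull of the orbit of
   [v]; by the parallelogram law, closure under midpoints is all that is needed.
     *)
Lemma ex_fixed_hull K v : subgroup K -> exists w, fixed K w /\
  forall e : R, 0 < e -> exists2 a, hull K v a & nrm (w - a) < e.
Proof.
move=> gK; have [K1 KM KV] := gK.
pose S := [set nrm a | a in hull K v]; pose m := inf S.
have S0 : has_inf S.
  split; last by exists 0 => _ [a _ <-]; exact: nrm_ge0.
  by exists (nrm (pi 1%g v)), (pi 1%g v) => //; exact: hull_rep.
have mle a : hull K v a -> m <= nrm a.
  by move=> ha; apply: ge_inf; [exact: S0.2|exists a].
have m0 : 0 <= m by apply: lb_le_inf; [exact: S0.1|move=> _ [a _ <-];
  exact: nrm_ge0].
have close (e : R) : 0 < e -> exists2 d, 0 < d & forall a b, hull K v a ->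
    hull K v b -> nrm a < m + d -> nrm b < m + d -> nrm (a - b) < e.
  (* By the parallelogram law and [2 * m <= nrm (a + b)], the square of [nrm (a - b)] is below
     [4 * (m + d) ^+ 2 - 4 * m ^+ 2], which is at most [d * (8 * m + 8)] as [d <= 1]. *)
  move=> e0; pose d := Num.min 1 (e ^+ 2 / (8 * m + 8)).
  have c0 : 0 < 8 * m + 8 by rewrite ltr_wpDl// mulr_ge0.
  have d0 : 0 < d by rewrite lt_min ltr01 divr_gt0// exprn_gt0.
  have d1 : d <= 1 by rewrite ge_min lexx.
  have de : d * (8 * m + 8) <= e ^+ 2 by rewrite -ler_pdivlMr// ge_min lexx
    orbT.
  exists d => // a b ha hb am bm.
  have := mle _ (hull_mid ha hb); rewrite half_nrm ler_pdivlMr// => abm.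
  have := parallelogram a b; have := nrm_ge0 a; have := nrm_ge0 b.
  have := nrm_ge0 (a - b).
  move: (nrm (a + b)) (nrm (a - b)) (nrm a) (nrm b) am bm abm => p q x y.
  move=> xm ym pm q0 y0 x0 pq; rewrite ltNge; apply/negP => eq_.
  have : e ^+ 2 <= q ^+ 2 by rewrite ler_pXn2r// nnegrE ltW.
  have : (2 * m) ^+ 2 <= p ^+ 2 by rewrite ler_pXn2r// ?nnegrE; lra.
  have : x ^+ 2 < (m + d) ^+ 2 by rewrite ltr_pXn2r// ?nnegrE; lra.
  have : y ^+ 2 < (m + d) ^+ 2 by rewrite ltr_pXn2r// ?nnegrE; lra.
  nra.
have ex_near (d : R) : 0 < d -> exists2 a, hull K v a & nrm a < m + d.
  move=> d0; have [_ [a ha <-] am] := inf_adherent d0 S0.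
  by exists a.
pose F : set_system H := filter_from [set d : R | 0 < d]
  (fun d => [set a | hull K v a /\ nrm a < m + d]).
have FF : ProperFilter F.
  apply: filter_from_proper; last by move=> d /ex_near[a ? ?]; exists a.
  apply: filter_from_filter; first by exists 1; rewrite /= ltr01.
  move=> d d' /= d0 d'0; exists (Num.min d d'); first by rewrite /= lt_min d0.
  move=> a [ha am]; split; split=> //; apply: lt_le_trans am _; rewrite lerD2l.
    by rewrite ge_min lexx.
  by rewrite ge_min lexx orbT.
have Fc : cauchy F.
  apply: cauchy_exP => e /gt0C[r r0 ->].
  have [d d0 dP] := close _ r0; have [a ha am] := ex_near _ d0.
  by exists a; exists d => // b [hb bm]; apply/ballC; exact: dP.
have /cvg_ex[w Fw] : cvg F by exact: cauchy_cvg.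
have wP (e d : R) : 0 < e -> 0 < d ->
    exists a, [/\ hull K v a, nrm a < m + d & nrm (w - a) < e].
  move=> e0 d0; have : F (ball w e%:C) by apply: Fw; apply: nbhsx_ballx;
    rewrite ltcR.
  move=> [d' d'0 dw]; have [|a ha] := ex_near (Num.min d d').
    by rewrite lt_min d0.
  move=> am; exists a; split=> //.
    by apply: lt_le_trans am _; rewrite lerD2l ge_min lexx.
  apply/ballC/dw; split=> //.
  by apply: lt_le_trans am _; rewrite lerD2l ge_min lexx orbT.
exists w; split; last by move=> e e0; have [a []] := wP _ _ e0 e0; exists a.
move=> g Kg; apply/eqP; rewrite -subr_eq0 -nrm_eq0 eq_le nrm_ge0 andbT.
apply/ler_addgt0Pr => e e0; rewrite add0r.
(* If [a] nearly attains the infimum then so does [pi g a], which has the same norm; hence the two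
   are close. *)
have e3 : 0 < e / 3 by rewrite divr_gt0.
have [d d0 dP] := close _ e3; have [a [ha am aw]] := wP _ _ e3 d0.
have := nrm_dist (pi g a) (pi g w) w; have := nrm_dist a (pi g a) w.
rewrite -linearB rep_nrm (nrmB a).
have := dP _ _ (hull_act gK Kg ha) ha; rewrite rep_nrm => /(_ am am).
lra.
Qed.

(** For a subgroup [K] this is the orthogonal projection to the [K]-fixed vectors: dot products with
    a fixed vector are constant on the hull. The description by averages is kept because finite
    averages can be compared with finite sets of isometries. *)
Definition proj K v : H :=
  xget 0 [set w | fixed K w /\
    forall e : R, 0 < e -> exists2 a, hull K v a & nrm (w - a) < e].

Section Projection.
Variable K : set (isom U).
Hypothesis gK : subgroup K.

Lemma projP v : fixed K (proj K v) /\
  forall e : R, 0 < e -> exists2 a, hull K v a & nrm (proj K v - a) < e.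
Proof. exact: xgetPex (ex_fixed_hull v gK). Qed.

Lemma proj_fixed v : fixed K (proj K v). Proof. by have [] := projP v. Qed.

Lemma proj_hull v (e : R) : 0 < e ->
  exists2 a, hull K v a & nrm (proj K v - a) < e.
Proof. by have [_] := projP v; exact. Qed.

Lemma proj_dot v u : fixed K u -> dot (proj K v) u = dot v u.
Proof.
move=> uK; apply/eqP; rewrite -subr_eq0 -dotBl; apply/eqP.
apply: (@dot_small _ _ _ _ (nrm u)) => e /(proj_hull v)[a ha wa].
rewrite dotBl -(hull_dot uK ha) -dotBl; apply: le_trans (cauchy_schwarz _ _) _.
by rewrite ler_wpM2r ?nrm_ge0// ltW.
Qed.

Lemma fixedB u v : fixed K u -> fixed K v -> fixed K (u - v).
Proof. by move=> uK vK g Kg; rewrite linearB uK ?vK. Qed.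

Lemma fixedZD (a : R[i]) u v : fixed K u -> fixed K v -> fixed K (a *: u + v).
Proof. by move=> uK vK g Kg; rewrite linearP uK ?vK. Qed.

Lemma proj_unique v w : fixed K w -> (forall u,
  fixed K u -> dot w u = dot v u) ->
  proj K v = w.
Proof.
move=> wK wv; have fB : fixed K (proj K v - w).
  by apply: fixedB => //; exact: proj_fixed.
have : dot (proj K v - w) (proj K v - w) = 0.
  by rewrite [LHS]dotBl proj_dot// wv// subrr.
rewrite dotvv => /complexI/eqP; rewrite expf_eq0 /= nrm_eq0 subr_eq0.
by move/eqP.
Qed.

Lemma proj_id v : fixed K v -> proj K v = v.
Proof. by move=> vK; exact: proj_unique. Qed.

Lemma proj_linear (a : R[i]) u v : proj K (a *: u + v) =
  a *: proj K u + proj K v.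
Proof.
apply: proj_unique; first by apply: fixedZD; exact: proj_fixed.
by move=> w wK; rewrite !dotDl !dotZl !proj_dot.
Qed.

Lemma proj_hull_eq v a : hull K v a -> proj K a = proj K v.
Proof.
move=> ha; apply: proj_unique; first exact: proj_fixed.
by move=> u uK; rewrite proj_dot// (hull_dot uK ha).
Qed.

Lemma proj_pythagoras v :
  nrm v ^+ 2 = nrm (proj K v) ^+ 2 + nrm (v - proj K v) ^+ 2.
Proof.
rewrite -pythagoras; first by rewrite addrC subrK.
rewrite dotC dotBl -(@proj_dot v) ?subrr ?conjC0//; exact: proj_fixed.
Qed.

Lemma nrm_proj v : nrm (proj K v) <= nrm v.
Proof.
rewrite -(@ler_pXn2r _ 2) ?nnegrE ?nrm_ge0// (proj_pythagoras v) lerDl.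
by rewrite exprn_ge0// nrm_ge0.
Qed.

Lemma nrm_proj_compl v : nrm (v - proj K v) <= nrm v.
Proof.
rewrite -(@ler_pXn2r _ 2) ?nnegrE ?nrm_ge0// (proj_pythagoras v) lerDr.
by rewrite exprn_ge0// nrm_ge0.
Qed.

End Projection.

(* [proj K v] is close to a finite average over [K], and finitely many elements
   of [K] already lie in some member of the chain. *)
Lemma proj_chain (I : Type) (Q : set I) (K_ : I -> set (isom U)) K v (e : R) :
  (forall i, Q i -> subgroup (K_ i)) -> subgroup K ->
  (forall i, Q i -> K_ i `<=` K) ->
  (forall s : seq (isom U), (forall g, g \in s -> K g) ->
    exists2 i, Q i & forall g, g \in s -> K_ i g) ->
  (fixed K `<=` [set 0]) -> 0 < e ->
  exists2 i, Q i & forall j, Q j -> K_ i `<=` K_ j -> nrm (proj (K_ j) v) < e.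
Proof.
move=> gKi gK KiK sK K0 e0.
have [a ha] := proj_hull gK v e0; rewrite (K0 _ (proj_fixed gK v)) sub0r nrmN =>
  ae.
have [s [/sK[i Qi si] hs]] := hull_finite ha.
exists i => // j Qj ij; rewrite -(@proj_hull_eq _ (gKi _ Qj) v a).
  by apply: le_lt_trans ae; exact/nrm_proj/gKi.
by apply: hull_sub hs => g /= /si; exact: ij.
Qed.

End FixedVectors.

(** * Stabilizers of balls *)

Section IsometryTopology.
Variables (R : realType) (U : metricType R).

(** The sets of isometries close to [h] at finitely many points generate a filter that converges
    pointwise to [h], so it contains every neighbourhood. *)
Lemma nbhs_isom (h : isom U) (W : set (isom U)) : nbhs h W ->
  exists (F : seq U) (r : R), 0 < r /\
    forall h' : isom U, (forall f, f \in F -> mdist (h f) (h' f) < r) -> W h'.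
Proof.
move=> [_ [[B Bop <-] Bh BW]].
pose G : set_system (isom U) := filter_from [set Fr : seq U * R | 0 < Fr.2]
  (fun Fr => [set h' : isom U | forall f, f \in Fr.1 ->
    mdist (h f) (h' f) < Fr.2]).
have GF : Filter G.
  apply: filter_from_filter; first by exists ([::], 1); rewrite /= ltr01.
  move=> [F r] [F' r'] /= r0 r'0; exists (F ++ F', Num.min r r').
    by rewrite /= lt_min r0.
  by move=> h' /= hh'; split=> f fF; have := hh' f;
    rewrite mem_cat fF ?orbT lt_min => /(_ isT) /andP[].
have Gh : {ptws, (@isom_fun R U @ G) --> (h : U -> U)}.
  apply/pointwise_cvgP => t A /nbhs_ballP[r r0 rA].
  exists ([:: t], r) => // h' /= hh'; apply: rA; rewrite ballEmdist /=.
  by apply: hh'; rewrite mem_head.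
have /Gh[[F r] /= r0 FrB] : nbhs (h : {ptws U -> U}) B by exact: open_nbhs_nbhs.
by exists F, r; split=> // h' /FrB /BW.
Qed.

Lemma eval_isom_continuous (x : U) : continuous (fun g : isom U => g x).
Proof.
move=> h A Ah; have hc := @initial_continuous _ {ptws U -> U} (@isom_fun R U) h.
exact: hc (@proj_continuous U (fun=> U) x (h : U -> U) A Ah).
Qed.

End IsometryTopology.

(** * Projections of fixed vectors, and minimal tuples of balls *)

Section Independence.
Variables (R : realType) (L : set R) (U : metricType R).
Hypothesis L_pos : forall r, L r -> 0 < r.
Hypothesis HU : urysohn L U.
Let U_ultra := urysohn_ultrametric HU.
Variables (H : hilbert R) (pi : unitary_rep U H).

Lemma rep_near (v : H) (h : isom U) (e : R) : 0 < e ->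
  exists (F : seq U) (r : R),
  0 < r /\ forall h' : isom U, (forall f, f \in F -> mdist (h f) (h' f) < r) ->
    nrm (pi h v - pi h' v) < e.
Proof.
move=> e0.
have /nbhs_isom[F [r [r0 FW]]] : nbhs h ((fun g => pi g v) @^-1` ball (pi h v)
  e%:C).
  by apply: rep_continuous; apply: nbhsx_ballx; rewrite ltcR.
by exists F, r; split=> // h' /FW /ballC.
Qed.

Lemma subgroup_stab n (x : 'I_n -> U) (D : 'I_n -> set R) :
  (forall i, cut (D i)) -> subgroup (pointwise_stab x D).
Proof.
move=> cD; split.
- by move=> i; rewrite mdistxx; exact: cut0.
- move=> g h gS hS i; apply: (cut_mdist HU (cD i) (gS i)).
  by rewrite /= isom_mdist; exact: hS.
- move=> g gS i; rewrite -(isom_mdist g) metric_sym isom_invK; exact: gS.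
Qed.

(* The projection [w] is nearly an average of translates of [v] by [stab x D].
   Another element of that stabilizer moves the average into general position,
   where [h] can be corrected, without changing it much on [w], so as to fix all
   the translates; hence [h] nearly fixes [w]. *)
Lemma proj_meet n m (x : 'I_n -> U) (D : 'I_n -> set R) (y : 'I_m -> U)
    (E : 'I_m -> set R) (v : H) (h : isom U) :
  (0 < n)%N -> (forall i, cut (D i)) -> (forall j, cut (E j)) ->
  (forall i j, i != j -> ~ D i (mdist (x i) (x j))) ->
  fixed pi (pointwise_stab y E) v ->
  (forall i j, let d := mdist (x i) (h (x i)) in
     D i d \/ E j d \/ d <= mdist (x i) (y j)) ->
  fixed pi [set h] (proj pi (pointwise_stab x D) v).
Proof.
move=> n0 cD cE disj vE hDE _ ->; set K := pointwise_stab x D.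
have gK : subgroup K by exact: subgroup_stab.
set w := proj pi K v; apply/eqP; rewrite -subr_eq0 -nrm_eq0 eq_le nrm_ge0 andbT.
apply/ler_addgt0Pr => e e0; rewrite add0r.
have e3 : 0 < e / 3 by rewrite divr_gt0.
have [F [r [r0 Fr]]] := rep_near w h e3.
have [a ha wa] := proj_hull pi gK v e3.
have [s [sK hs]] := hull_finite ha.
have [g [h' [gS hh' forcedP]]] := general_position L_pos HU cD disj h F
  [seq g (y j) | g : isom U <- s, j <- enum 'I_m] n0.
have h'a : pi h' (pi g a) = pi g a.
  elim: hs => [k /= ks|a1 a2 _ h1 _ h2]; last by rewrite !linearZ !linearD h1
    h2.
  have kK := sK _ ks; rewrite -[RHS]repM -[pi g (pi k v)]repM.
  (* [h'] fixes the translate of [v] by [g * k] as soon as its conjugate by [g * k] fixes [v], that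
     is, as soon as [h'] displaces each [g (k (y j))] by an element of [E j]. *)
  suff /vE e1 : pointwise_stab y E ((g * k)^-1 * h' * (g * k))%g.
    rewrite -[in RHS]e1 -!repM; congr (pi _ v).
    by rewrite !mulgA mulgV mul1g.
  move=> j; set d := mdist _ _.
  have -> : d = mdist (g (k (y j))) (h' (g (k (y j)))).
    rewrite /d -(isom_mdist (g * k)%g); congr mdist.
    exact: (isom_invK (g * k)%g).
  have /forcedP[->|[i [-> nDi ki]]] : k (y j) \in
      [seq g (y j) | g : isom U <- s, j <- enum 'I_m].
    by apply/allpairsP; exists (k, j); rewrite /= mem_enum.
  - exact: cut0.
  case: (hDE i j) => [//|[//|le_d]]; exfalso.
  (* [k] moves [x i] by less than the forced displacement, so this displacement would exceed
     [mdist (x i) (y j)], against [le_d]. *)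
  have : mdist (k (x i)) (k (y j)) < mdist (x i) (h (x i)).
    apply: (ultra_lt U_ultra (y := x i)); last by rewrite metric_sym.
    by rewrite metric_sym; apply: cut_lt (kK i) nDi.
  by rewrite isom_mdist ltNge le_d.
have wg : pi g w = w by exact: proj_fixed.
have h'w := Fr h' (fun f fF => _).
have {h'w} : nrm (pi h w - pi h' w) < e / 3.
  by apply: Fr => f fF; rewrite hh'// mdistxx.
have : nrm (pi h' w - pi g a) < e / 3.
  by rewrite -h'a -linearB rep_nrm -{1}wg -linearB rep_nrm.
have : nrm (pi g a - w) < e / 3 by rewrite -{1}wg -linearB rep_nrm nrmB.
have := nrm_dist (pi h' w) (pi h w) w; have := nrm_dist (pi g a) (pi h' w) w.
lra.
Qed.

Lemma min_subset (T : Type) m (f : 'I_m -> set T) : (0 < m)%N ->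
  (forall j k, f j `<=` f k \/ f k `<=` f j) -> exists j, forall k,
    f j `<=` f k.
Proof.
move=> m0 tot; suff [j jmin] : exists j, forall k,
  k \in enum 'I_m -> f j `<=` f k.
  by exists j => k; apply: jmin; rewrite mem_enum.
elim: (enum 'I_m) => [|i s [j jmin]]; first by exists (Ordinal m0).
have [ij|ji] := tot i j.
  by exists i => k; rewrite inE => /predU1P[->//|/jmin]; exact: subset_trans.
by exists j => k; rewrite inE => /predU1P[->//|/jmin].
Qed.

(* The cut of the smallest ball around [x] that contains the balls of cut [D]
   around [x] and of cut [E] around [y], where [r] is the distance of [x] and
     [y]. *)
Definition join_cut (D E : set R) (r : R) : set R :=
  [set t | D t \/ E t \/ t <= r].

Lemma cut_join D E r : cut D -> cut E -> cut (join_cut D E r).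
Proof.
move=> [Dle [e e0 De]] [Ele _]; split; last by exists e => //; left.
move=> s t st [|[|tr]]; [by left; exact: Dle st _|by right; left;
  exact: Ele st _|].
by right; right; exact: le_trans tr.
Qed.

Lemma cut_total (D E : set R) : cut D -> cut E -> D `<=` E \/ E `<=` D.
Proof.
move=> cD cE; have [DE|DE] := pselect (D `<=` E); first by left.
right=> t Et; apply: contrapT => nDt; apply: DE => s Ds.
by apply: cut_le cE _ Et; apply/ltW/(cut_lt cD Ds nDt).
Qed.

(** [proj_meet] asks that [h] preserve, for all [i] and [k], the join of the ball [i] of [x] with
    the ball [k] of [y]. For fixed [i] these joins have the same centre, so they are nested, and it
    suffices to preserve the smallest one. *)
Lemma proj_join n m (x : 'I_n -> U) (D : 'I_n -> set R) (y : 'I_m -> U)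
    (E : 'I_m -> set R) (v : H) :
  (0 < n)%N -> (0 < m)%N -> (forall i, cut (D i)) -> (forall j, cut (E j)) ->
  (forall i j, i != j -> ~ D i (mdist (x i) (x j))) ->
  fixed pi (pointwise_stab y E) v ->
  exists j : 'I_n -> 'I_m,
    fixed pi (pointwise_stab x (fun i => join_cut (D i) (E (j i)) (mdist (x i)
      (y (j i)))))
      (proj pi (pointwise_stab x D) v).
Proof.
move=> n0 m0 cD cE disj vE.
have /choice[j jP] i : exists j, forall k,
    join_cut (D i) (E j) (mdist (x i) (y j)) `<=`
    join_cut (D i) (E k) (mdist (x i) (y k)).
  by apply: min_subset => // k l; apply: cut_total; exact: cut_join.
exists j => h hS; apply: (proj_meet n0 cD cE disj vE (h := h)) => // i k.
exact: jP (hS i).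
Qed.

Definition has_fixed n (x : 'I_n -> U) (D : 'I_n -> set R) : Prop :=
  (forall i, cut (D i)) /\ exists2 v, v != 0 & fixed pi (pointwise_stab x D) v.

Lemma fixed_sub (K K' : set (isom U)) (v : H) :
  K `<=` K' -> fixed pi K' v -> fixed pi K v.
Proof. by move=> KK' vK g /KK'; exact: vK. Qed.

(** The ball around [x j] lies in the one around [x i], so an isometry that preserves the smaller
    ball also preserves the larger one, which may be dropped. *)
Lemma has_fixed_drop n (x : 'I_n.+1 -> U) (D : 'I_n.+1 -> set R) i j :
  i != j -> D i (mdist (x i) (x j)) -> D j `<=` D i -> has_fixed x D ->
  has_fixed (x \o lift i) (D \o lift i).
Proof.
move=> ij Dij DjDi [cD [v v0 vx]]; split; first by move=> k; exact: cD.
exists v => //; apply: fixed_sub vx => g gS k.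
case: (unliftP i k) => [k' ->|->]; first exact: gS.
case: (unliftP i j) ij => [j' jE _|->]; last by rewrite eqxx.
apply: (cut_mdist HU (cD i) Dij); apply: (cut_mdist HU (cD i) (y := g (x j))).
  by apply: DjDi; rewrite jE; exact: gS.
by rewrite isom_mdist metric_sym.
Qed.

Lemma has_fixed_overlap n (x : 'I_n -> U) (D : 'I_n -> set R) i j :
  i != j -> D i (mdist (x i) (x j)) -> has_fixed x D ->
  exists m (x' : 'I_m -> U) (D' : 'I_m -> set R),
    [/\ (0 < m)%N, (m < n)%N & has_fixed x' D'].
Proof.
case: n => [|[|n]] in x D i j *; first by case: i.
  by rewrite (ord1 i) (ord1 j) eqxx.
move=> ij Dij fx; have [cD _] := fx; exists n.+1.
have [DjDi|DiDj] := cut_total (cD j) (cD i).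
  exists (x \o lift i), (D \o lift i); split=> //.
  exact: has_fixed_drop ij Dij DjDi fx.
exists (x \o lift j), (D \o lift j); split=> //.
apply: (has_fixed_drop _ _ DiDj fx); first by rewrite eq_sym.
by rewrite metric_sym; exact: DiDj.
Qed.

Lemma ex_has_fixed : (exists v : H, v != 0) -> exists n (x : 'I_n -> U) D,
  (0 < n)%N /\ has_fixed x D.
Proof.
move=> [v v0]; have [x0] := urysohn_inhabited HU.
have v2 : 0 < nrm v / 2 by rewrite divr_gt0// nrm_gt0.
have [F [r [r0 Fr]]] := rep_near v 1%g v2.
(* The extra point [x0] keeps the tuple nonempty even if [F] is empty. *)
pose x := tnth (in_tuple (x0 :: F)); pose D (i : 'I_(size F).+1) :=
  [set t : R | t < r].
have cD i : cut (D i).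
  split; last by exists (r / 2); rewrite ?divr_gt0//= /D/= ltr_pdivrMr//
    ltr_pMr// ltr1n.
  by move=> s t st; exact: le_lt_trans.
exists (size F).+1, x, D; split=> //; split=> //.
have gK := subgroup_stab x cD.
exists (proj pi (pointwise_stab x D) v); last exact: proj_fixed.
have [a ha wa] := proj_hull pi gK v v2.
rewrite -nrm_gt0.
(* The averages over the stabilizer stay within half the norm of [v], so the projection cannot
   vanish. *)
have : nrm (a - v) <= nrm v / 2.
  apply: hull_close ha => g gS; rewrite nrmB ltW// -{1}(rep1 pi v).
  apply: Fr => f fF.
  have fF' : f \in x0 :: F by rewrite inE fF orbT.
  have fi : (index f (x0 :: F) < (size F).+1)%N.
    by have := fF'; rewrite -index_mem.
  have := gS (Ordinal fi); rewrite /D /= /x (tnth_nth x0).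
  have -> : nth x0 (in_tuple (x0 :: F)) (Ordinal fi) = f by exact: nth_index.
  by [].
have := nrm_dist (proj pi (pointwise_stab x D) v) v 0.
have := nrm_dist a v (proj pi (pointwise_stab x D) v); rewrite !subr0.
move: wa; rewrite !(nrmB _ a) (nrmB v) => ? ? ? ?; lra.
Qed.

Lemma ex_min_has_fixed : (exists v : H, v != 0) -> exists n : nat,
  [/\ (0 < n)%N, exists (x : 'I_n -> U) D, has_fixed x D &
   forall (x : 'I_n -> U) D, has_fixed x D ->
     forall i j, i != j -> ~ D i (mdist (x i) (x j))].
Proof.
move=> /ex_has_fixed[n [x [D [n0 fx]]]].
pose P n := `[< (0 < n)%N /\ exists (x : 'I_n -> U) D, has_fixed x D >].
have exP : exists n, P n by exists n; apply/asboolP; split=> //; exists x, D.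
case: (ex_minnP exP) => m /asboolP[m0 fm] mmin; exists m; split=> //.
move=> y E fy i j ij Eij.
have [k [z [E' [k0 km fz]]]] := has_fixed_overlap ij Eij fy.
suff /mmin : P k by rewrite leqNgt km.
by apply/asboolP; split=> //; exists z, E'.
Qed.

End Independence.

(** * Extremal families of balls *)

Section Irreducible.
Variables (R : realType) (U : metricType R) (H : hilbert R) (pi : unitary_rep U
  H).
Hypothesis pi_irr : irreducible pi.

(** Irreducibility as a principle for proving a property of all vectors from one nonzero vector;
    closedness is phrased by approximation, to be checked by estimates. *)
Lemma irreducible_all (W : set H) (w : H) :
  (forall v, (forall e : R, 0 < e -> exists2 v',
    W v' & nrm (v - v') < e) -> W v) ->
  (forall (a : R[i]) v v', W v -> W v' -> W (a *: v + v')) ->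
  (forall g v, W v -> W (pi g v)) -> W w -> w != 0 -> forall v, W v.
Proof.
move=> Wcl WD Wg Ww w0.
have W0 : W 0 by have := WD (-1) w w Ww Ww; rewrite scaleN1r addNr.
have cW : closed_subspace W.
  split=> // v clv; apply: Wcl => e e0.
  have [|v' [Wv' /ballC ?]] := clv (ball v e%:C); last by exists v'.
  by apply: nbhsx_ballx; rewrite ltcR.
have [W1|WT] := pi_irr.2 W cW Wg; last by move=> v; rewrite WT.
by move: Ww w0; rewrite W1 => ->; rewrite eqxx.
Qed.

End Irreducible.

(** * Products of complementary projections *)

Section Residual.
Variables (R : realType) (U : metricType R) (H : hilbert R) (pi : unitary_rep U
  H).
Variables (I : eqType) (K_ : I -> set (isom U)).
Hypothesis gK : forall s, subgroup (K_ s).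
Hypothesis stable : forall s t v, fixed pi (K_ t) v ->
  fixed pi (K_ t) (proj pi (K_ s) v).

(** The composite of the operators that subtract the projections. By [stable], each of them
    preserves the fixed vectors of every [K_ t], so the composite annihilates all these vectors: the
    factor of index [t] does so, and the earlier factors do not lead out of them. *)
Fixpoint residual (l : seq I) (v : H) : H :=
  if l is s :: l' then residual l' (v - proj pi (K_ s) v) else v.

Lemma residual_linear l (a : R[i]) u v :
  residual l (a *: u + v) = a *: residual l u + residual l v.
Proof.
elim: l u v => //= s l IH u v; rewrite -IH; congr (residual l _).
by rewrite proj_linear// scalerBr opprD addrACA.
Qed.

Lemma residual0 l : residual l 0 = 0.
Proof. by have := residual_linear l (-1) 0 0; rewrite !scaleN1r !addNr. Qed.

Lemma residualB l u v : residual l (u - v) = residual l u - residual l v.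
Proof. by rewrite addrC -scaleN1r residual_linear scaleN1r addrC. Qed.

Lemma nrm_residual l v : nrm (residual l v) <= nrm v.
Proof.
elim: l v => //= s l IH v; apply: le_trans (IH _) _; exact: nrm_proj_compl.
Qed.

Lemma residual_fixed l s v : s \in l -> fixed pi (K_ s) v -> residual l v = 0.
Proof.
elim: l v => //= t l IH v; rewrite inE => /predU1P[-> vt|sl vs].
  by rewrite proj_id// subrr residual0.
by apply: IH => //; apply: fixedB => //; exact: stable.
Qed.

(** Telescoping: the factor of index [s] contributes the residual of [proj pi (K_ s) v], and
    residuals do not increase norms. *)
Lemma residual_bound l v :
  nrm (v - residual l v) <= \sum_(s <- l) nrm (proj pi (K_ s) v).
Proof.
elim: l => [|s l IH] /=; first by rewrite big_nil subrr nrm0.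
rewrite big_cons residualB opprB addrCA.
apply: le_trans (nrmD _ _) _; rewrite lerD//; exact: nrm_residual.
Qed.

End Residual.

Section Extremal.
Variables (R : realType) (L : set R) (U : metricType R).
Hypothesis L_pos : forall r, L r -> 0 < r.
Hypothesis HU : urysohn L U.
Variables (H : hilbert R) (pi : unitary_rep U H).
Hypothesis pi_irr : irreducible pi.
Variable n : nat.
Hypothesis n_gt0 : (0 < n)%N.
Hypothesis disjoint_balls : forall (x : 'I_n -> U) D, has_fixed pi x D ->
  forall i j, i != j -> ~ D i (mdist (x i) (x j)).
Implicit Types (x y : 'I_n -> U) (D E tau : 'I_n -> set R) (s : {perm 'I_n}).

Definition joined x D y E (j : 'I_n -> 'I_n) (i : 'I_n) : set R :=
  join_cut (D i) (E (j i)) (mdist (x i) (y (j i))).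

Lemma cut_joined x D y E j : (forall i, cut (D i)) -> (forall i, cut (E i)) ->
  forall i, cut (joined x D y E j i).
Proof. by move=> cD cE i; exact: cut_join. Qed.

Lemma stab_subset x D E : (forall i, D i `<=` E i) ->
  pointwise_stab x D `<=` pointwise_stab x E.
Proof. by move=> DE g gS i; apply: DE; exact: gS. Qed.

Lemma stab_joined x D y E j : (forall i, cut (D i)) -> (forall i, cut (E i)) ->
  pointwise_stab y E `<=` pointwise_stab x (joined x D y E j).
Proof.
move=> cD cE g gS i; have cJ := cut_joined x y j cD cE i.
have xy : joined x D y E j i (mdist (x i) (y (j i))) by right; right.
apply: (cut_mdist HU cJ xy); apply: (cut_mdist HU cJ (y := g (y (j i)))).
  by right; left; exact: gS.
by rewrite isom_mdist metric_sym.
Qed.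

Lemma not_has_fixed x D v : (forall i, cut (D i)) -> ~ has_fixed pi x D ->
  fixed pi (pointwise_stab x D) v -> v = 0.
Proof.
move=> cD nf vf; apply/eqP; apply: contra_notT nf => v0.
by split=> //; exists v.
Qed.

Lemma fixed_act y E (g : isom U) v : fixed pi (pointwise_stab y E) v ->
  fixed pi (pointwise_stab (g \o y) E) (pi g v).
Proof.
move=> vf h hS; have /vf e1 : pointwise_stab y E (g^-1 * h * g)%g.
  move=> i; rewrite -(isom_mdist g).
  have -> : g ((g^-1 * h * g)%g (y i)) = h (g (y i)) by exact: isom_invK.
  exact: hS.
by rewrite -[in RHS]e1 -!repM !mulgA mulgV mul1g.
Qed.

(** If the index map of [proj_join] took one value twice, two of the joined balls would contain the
    same point, and overlapping is excluded by [disjoint_balls]. So the map is a permutation. *)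
Lemma proj_joined x D y E v : has_fixed pi x D -> (forall i, cut (E i)) ->
  fixed pi (pointwise_stab y E) v -> proj pi (pointwise_stab x D) v != 0 ->
  exists s, has_fixed pi x (joined x D y E s) /\
    fixed pi (pointwise_stab x (joined x D y E s)) (proj pi (pointwise_stab x D)
      v).
Proof.
move=> fx cE vE w0; have [cD _] := fx.
have [j jf] := proj_join L_pos HU n_gt0 n_gt0 cD cE (disjoint_balls fx) vE.
have fJ : has_fixed pi x (joined x D y E j).
  by split; [exact: cut_joined|exists (proj pi (pointwise_stab x D) v)].
have jinj : injective j.
  move=> i k jik; apply/eqP/negPn/negP => ik.
  have cJ := cut_joined x y j cD cE.
  have xy l : joined x D y E j l (mdist (x l) (y (j l))) by right; right.
  have := xy k; rewrite -jik metric_sym => xk.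
  have [JJ|JJ] := cut_total (cJ i) (cJ k).
    apply: (disjoint_balls fJ (i := k) (j := i)); first by rewrite eq_sym.
    apply: (cut_mdist HU (cJ k) (y := y (j i))); first by rewrite metric_sym.
    by rewrite metric_sym; apply: JJ.
  apply: (disjoint_balls fJ ik); apply: (cut_mdist HU (cJ i) (xy i)).
  exact: JJ.
have sE : (perm jinj : 'I_n -> 'I_n) = j by apply/funext => i; rewrite permE.
by exists (perm jinj); rewrite sE.
Qed.

(** The part of [joined] that comes from the radii alone. It is independent of the other centres, so
    finitely many such families serve for all the translates of a tuple at once. *)
Definition enlarge D tau s (i : 'I_n) : set R := D i `|` tau (s i).

Lemma cut_setU (A B : set R) : cut A -> cut B -> cut (A `|` B).
Proof.
move=> [Ale [e e0 Ae]] [Ble _]; split; last by exists e => //; left.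
by move=> s t st [/(Ale _ _ st)|/(Ble _ _ st)]; [left|right].
Qed.

Lemma enlarge_stable x D tau s t v : (forall i, cut (D i)) -> (forall i,
  cut (tau i)) ->
  fixed pi (pointwise_stab x (enlarge D tau t)) v ->
  fixed pi (pointwise_stab x (enlarge D tau t))
    (proj pi (pointwise_stab x (enlarge D tau s)) v).
Proof.
move=> cD ct vt.
have cs r i : cut (enlarge D tau r i) by exact: cut_setU.
have gs := subgroup_stab HU x (cs s).
have [fs|nfs] := pselect (has_fixed pi x (enlarge D tau s)); last first.
  rewrite (not_has_fixed (cs s) nfs (proj_fixed pi gs v)) => g _.
  by rewrite linear0.
have [w0|w0] := eqVneq (proj pi (pointwise_stab x (enlarge D tau s)) v) 0.
  by rewrite w0 => g _; rewrite linear0.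
have [r [_ fr]] := proj_joined fs (cs t) vt w0.
by apply: fixed_sub fr; apply: stab_joined.
Qed.

(* The residual [T] after all the projections annihilates the projections to
   [H^stab(x,D)] of all translates of a vector fixed by [stab y E], and these
   translates span a dense subspace by irreducibility; so [T v = 0]. *)
Lemma enlarge_bound x D y E tau v : has_fixed pi x D -> has_fixed pi y E ->
  (forall i, cut (tau i)) -> (forall i, tau i `<=` E i) ->
  fixed pi (pointwise_stab x D) v ->
  nrm v <= \sum_(s <- enum {: {perm 'I_n}}) nrm (proj pi (pointwise_stab x
    (enlarge D tau s)) v).
Proof.
move=> fx [cE [u u0 uE]] ct tE vx; have [cD _] := fx.
pose K_ s := pointwise_stab x (enlarge D tau s).
have gK s : subgroup (K_ s) by apply: (subgroup_stab HU) => i; exact: cut_setU.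
have gD := subgroup_stab HU x cD.
pose T w := residual pi K_ (enum {: {perm 'I_n}}) (proj pi (pointwise_stab x D)
  w).
have TD (a : R[i]) w w' : T (a *: w + w') = a *: T w + T w'.
  by rewrite /T proj_linear// residual_linear.
have T0 : forall w g, T (pi g w) = 0.
  apply: (irreducible_all pi_irr (W := fun w => forall g,
    T (pi g w) = 0) (w := u)) => //.
  - move=> w wcl g; apply/eqP; rewrite -nrm_eq0 eq_le nrm_ge0 andbT.
    apply/ler_addgt0Pr => e /wcl[w' Ww' ww']; rewrite add0r;
      apply: le_trans (ltW ww').
    have -> : T (pi g w) = T (pi g (w - w')).
      by rewrite linearB addrC -scaleN1r TD Ww' scaler0 add0r.
    rewrite -(rep_nrm pi g (w - w')) /T; apply: le_trans (nrm_residual pi gK _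
      _) _.
    exact: nrm_proj.
  - by move=> a w w' h h' g; rewrite linearP TD h h' scaler0 addr0.
  - by move=> g w h g'; rewrite -repM.
  - move=> g; rewrite /T.
    have [->|w0] := eqVneq (proj pi (pointwise_stab x D) (pi g u)) 0.
      exact: residual0.
    have [s [_ sf]] := proj_joined fx cE (fixed_act uE) w0.
    apply: (residual_fixed gK _ (mem_enum _ s)).
    + by move=> *; exact: enlarge_stable.
    + apply: fixed_sub sf; apply: stab_subset => i t [Dt|tt]; first by left.
      by right; left; exact: tE.
have := residual_bound pi gK (enum {: {perm 'I_n}}) v.
by have := T0 v 1%g; rewrite rep1 /T (proj_id gD vx) => ->; rewrite subr0.
Qed.

Lemma has_fixed_perm x D s : has_fixed pi x D -> has_fixed pi (x \o s) (D \o s).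
Proof.
move=> [cD [v v0 vx]]; split; first by move=> i; exact: cD.
exists v => //; apply: fixed_sub vx => g gS i.
by have := gS (s^-1%g i); rewrite /= permKV.
Qed.

(** If the union of the chain failed for every [s], each of the finitely many projections of [v] in
    [enlarge_bound] would tend to 0 along the chain, by [proj_chain], although their norms add up to
    at least [nrm v]. *)
Lemma chain_has_fixed x D (A : set ('I_n -> set R)) :
  has_fixed pi x D -> A !=set0 ->
  (forall tau, A tau -> exists y, has_fixed pi y tau) ->
  (forall tau tau', A tau -> A tau' ->
    (forall i, tau i `<=` tau' i) \/ (forall i, tau' i `<=` tau i)) ->
  exists s, has_fixed pi x (enlarge D (fun i => \bigcup_(tau in A) tau i) s).
Proof.
move=> fx [tau0 A0] Af tot; have [cD [v v0 vx]] := fx.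
pose T (i : 'I_n) : set R := \bigcup_(tau in A) tau i.
have cA tau i : A tau -> cut (tau i) by move=> /Af[y [c _]]; exact: c.
have cT i : cut (T i).
  split; last by have [_ [e e0 te]] := cA _ i A0; exists e => //; exists tau0.
  by move=> a b ab [tau At tb]; exists tau => //;
    apply: cut_le (cA _ i At) ab tb.
apply: contrapT => nof.
pose K_ s tau := pointwise_stab x (enlarge D tau s).
have gK s tau : A tau -> subgroup (K_ s tau).
  by move=> At; apply: (subgroup_stab HU) => i; apply: cut_setU => //;
    exact: cA.
have gT s : subgroup (K_ s T).
  by apply: (subgroup_stab HU) => i; exact: cut_setU.
have maxA (tau tau' : 'I_n -> set R) : A tau -> A tau' -> exists2 t, A t &
    (forall i, tau i `<=` t i) /\ (forall i, tau' i `<=` t i).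
  move=> At At'; have [h|h] := tot _ _ At At'.
    by exists tau' => //; split=> // i; exact: subset_refl.
  by exists tau => //; split=> // i; exact: subset_refl.
(* One more than the number of permutations in the denominator, so that one term [e] for each
   permutation sums to strictly less than [nrm v]. *)
pose e : R := nrm v / (#|{perm 'I_n}|.+1)%:R.
have e0 : 0 < e by rewrite divr_gt0 ?nrm_gt0// ltr0n.
have small s : exists2 tau, A tau & forall t, A t -> (forall i,
  tau i `<=` t i) ->
    nrm (proj pi (K_ s t) v) < e.
  have [||||||tau At tauP] := @proj_chain _ _ _ pi _ A (K_ s) (K_ s T) v e.
  - by move=> tau; exact: gK.
  - exact: gT.
  - move=> tau At; apply: stab_subset => i t [Dt|tt]; [by left|right].
    by exists tau.
  (* Membership of finitely many isometries in the stabilizer for the union is a condition on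
     finitely many distances; each is met by some member of the chain, hence all are met by one
     member. *)
  - move=> l lT; elim: l lT => [|g l IH] lT; first by exists tau0.
    have [|tau At lt] := IH; first by move=> h hl; apply: lT;
      rewrite inE hl orbT.
    have gl : K_ s T g by apply: lT; rewrite mem_head.
    suff [t At' gt] : exists2 t, A t & K_ s t g.
      have [r Ar [r1 r2]] := maxA _ _ At At'; exists r => // h.
      rewrite inE => /predU1P[->|/lt].
        by move: gt; apply: stab_subset => i z [Dz|tz]; [left|right; exact: r2].
      by apply: stab_subset => i z [Dz|tz]; [left|right; exact: r1].
    suff [t At' gt] : exists2 t, A t & forall i, i \in enum 'I_n ->
        enlarge D t s i (mdist (x i) (g (x i))).
      by exists t => // i; apply: gt; rewrite mem_enum.
    elim: (enum 'I_n) => [|i l' [t At' tl']]; first by exists tau0.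
    have [t' At'' t'i] : exists2 t, A t & enlarge D t s i (mdist (x i) (g (x
      i))).
      by case: (gl i) => [Di|[t' ? ?]]; [exists tau0 => //;
        left|exists t' => //; right].
    have [r Ar [r1 r2]] := maxA _ _ At' At''; exists r => // k.
    rewrite inE => /predU1P[->|/tl'[]].
    + by case: t'i => [|/r2]; [left|right].
    + by left.
    + by move=> /r1; right.
  - by move=> w; apply: not_has_fixed => [i|];
    [exact: cut_setU|apply: contra_not nof; exists s].
  - exact: e0.
  exists tau => // t Att tt; apply: tauP => //.
  by apply: stab_subset => i z [Dz|tz]; [left|right; exact: tt].
have [tau At smallt] : exists2 tau, A tau & forall s,
  s \in enum {: {perm 'I_n}} ->
    nrm (proj pi (K_ s tau) v) < e.
  suff [tau At ht] : exists2 tau, A tau & forall s,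
    s \in enum {: {perm 'I_n}} ->
      forall t, A t -> (forall i, tau i `<=` t i) ->
        nrm (proj pi (K_ s t) v) < e.
    by exists tau => // s sl; apply: (ht s sl tau At) => i; exact: subset_refl.
  elim: (enum {: {perm 'I_n}}) => [|s l [tau At ht]]; first by exists tau0.
  have [tau' At' ht'] := small s.
  have [r Ar [r1 r2]] := maxA _ _ At At'; exists r => // s'.
  rewrite inE => /predU1P[->|sl] t Att rt.
    by apply: ht' => // i; exact: subset_trans (rt i).
  by apply: ht => // i; exact: subset_trans (rt i).
have [y fy] := Af _ At.
have := enlarge_bound fx fy (fun i => cA _ i At) (fun i => @subset_refl _ _) vx.
rewrite leNgt => /negP; apply.
apply: (@le_lt_trans _ _ (\sum_(s <- enum {: {perm 'I_n}}) e)).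
  by rewrite big_seq [leRHS]big_seq; apply: ler_sum => s sl; exact/ltW/smallt.
rewrite big_const_seq count_predT iter_addr addr0 -cardE /e -mulrnAr.
rewrite gtr_pMr ?nrm_gt0// -[X in X *+ _]mul1r -mulrnAl ltr_pdivrMr ?ltr0n//.
by rewrite mul1r ltr_nat.
Qed.

(** Zorn's lemma is applied to the radii alone, with the centres under an existential quantifier,
    since they may change along a chain. The upper bound from [chain_has_fixed] is attached to
    permuted indices, and the family is reindexed by the inverse permutation. *)
Lemma ex_maximal : (exists x D, has_fixed pi x D) -> exists x D,
  has_fixed pi x D /\
  forall y E, has_fixed pi y E -> (forall i, D i `<=` E i) -> forall i,
    E i `<=` D i.
Proof.
move=> [x0 [D0 f0]].
pose T := {D : 'I_n -> set R | exists x, has_fixed pi x D}.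
pose Q (D E : T) := `[< forall i, sval D i `<=` sval E i >].
have [||A totA|[D [x fx]] Dmax] := @ZL_preorder T (exist _ D0 (ex_intro _ x0
  f0)) Q.
- by move=> D; apply/asboolP => i; exact: subset_refl.
- move=> r s t /asboolP rs /asboolP st; apply/asboolP => i.
  exact: subset_trans (st i).
- have [[D AD]|A0] := pselect (A !=set0); last first.
    exists (exist _ D0 (ex_intro _ x0 f0)) => s As; exfalso; apply: A0;
      by exists s.
  have [||||s fs] := @chain_has_fixed x0 D0 [set sval E | E in A].
  - exact: f0.
  - by exists (sval D), D.
  - by move=> _ [E AE <-]; exact: (svalP E).
  - move=> _ _ [E AE <-] [E' AE' <-].
    by have [/asboolP|/asboolP] := totA E E' AE AE'; [left|right].
  have := has_fixed_perm s^-1%g fs; set D1 := (X in has_fixed _ _ X) => f1.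
  have f1x : exists x, has_fixed pi x D1 by exists (x0 \o s^-1%g).
  exists (exist _ D1 f1x) => E AE; apply/asboolP => i t Et.
  by right; exists (sval E); [exists E|rewrite permKV].
exists x, D; split=> // y E fy DE i.
have Ef : exists y, has_fixed pi y E by exists y.
have /asboolP := Dmax (exist _ E Ef) (introT (asboolP _) DE).
exact.
Qed.

(** The inclusions run around the cycles of [s], so they are equalities. *)
Lemma perm_decreasing D s : (forall i, D (s i) `<=` D i) -> forall i,
  D (s i) = D i.
Proof.
move=> Ds i; apply/seteqP; split; first exact: Ds.
have iterD k j : D ((s ^+ k)%g j) `<=` D j.
  elim: k j => [|k IH] j; first by rewrite expg0 perm1.
  by rewrite expgS permM; apply: subset_trans (IH _) (Ds _).
have := iterD #[s]%g.-1 (s i); rewrite -permM -expgS prednK ?order_gt0//.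
by rewrite expg_order perm1.
Qed.

(** If [pi g u] is not orthogonal to [u], its projection is nonzero and fixed by the stabilizer of
    the joined family. By maximality the joining has enlarged no ball, so the ball [s i] of the
    translated tuple coincides with the ball [i] of the original one. *)
Lemma ex_extremal : (exists x D, has_fixed pi x D) -> exists x D (u : H),
  [/\ forall i, cut (D i), u != 0, fixed pi (pointwise_stab x D) u &
   forall g, dot (pi g u) u != 0 -> exists s : {perm 'I_n},
     forall i, D (s i) = D i /\ D i (mdist (x i) (g (x (s i))))].
Proof.
move=> /ex_maximal[x [D [fx Dmax]]]; have [cD [u u0 ux]] := fx.
exists x, D, u; split=> // g gu.
have gD := subgroup_stab HU x cD.
have w0 : proj pi (pointwise_stab x D) (pi g u) != 0.
  by apply: contraNneq gu => w0; rewrite -(proj_dot gD _ ux) w0 dot0l.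
have [s [fs _]] := proj_joined fx cD (fixed_act ux) w0.
have sD := Dmax _ _ fs (fun i t Dt => or_introl Dt).
exists s => i; split; last by apply: sD; right; right.
by move: i; apply: perm_decreasing => i t Dt; apply: sD; right; left.
Qed.

End Extremal.

(** * The Hilbert space of square summable functions *)

Section Sums.
Variables (R : realType) (Y : choiceType).
Implicit Types (A B : {fset Y}) (f g : Y -> R[i]) (a : Y -> R).

Definition sums f (l : R[i]) : Prop := forall e : R, 0 < e ->
  exists A, forall B, (A `<=` B)%fset -> Normc.normc (\sum_(i <- B) f i - l) <=
    e.

Lemma sums_sum f l : sums f l -> summability.sum (f : Y -> R[i]^o) = l.
Proof.
move=> fl; rewrite /summability.sum; apply: (@cvg_lim _ (@norm_hausdorff _ _) _
  _ (@totally_filter Y)).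
have TF := @totally_filter Y.
apply/cvgrPdist_le => e /gt0C[r r0 ->]; have [A Ar] := fl r r0.
exists A => //= B AB; rewrite /partial_sum -(big_seq_fsetE _ _ xpredT f)/=.
by rewrite distrC normcE lecR; exact: Ar.
Qed.

Lemma sums_unique f l l' : sums f l -> sums f l' -> l = l'.
Proof. by move=> /sums_sum <- /sums_sum <-. Qed.

Lemma sumsD f g l m : sums f l -> sums g m -> sums (fun x => f x + g x) (l + m).
Proof.
move=> fl gm e e0; have e2 : 0 < e / 2 by rewrite divr_gt0.
have [A hA] := fl _ e2; have [B hB] := gm _ e2; exists (A `|` B)%fset => C.
rewrite fsubUset => /andP[/hA hAC /hB hBC].
rewrite big_split /= opprD addrACA; apply: le_trans (le_normcD _ _) _.
by rewrite [leRHS]splitr lerD.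
Qed.

Lemma sumsZ (c : R[i]) f l : sums f l -> sums (fun x => c * f x) (c * l).
Proof.
move=> fl e e0; have c0 : 0 < Normc.normc c + 1 by rewrite ltr_wpDl// normc_ge0.
have [A hA] := fl (e / (Normc.normc c + 1)) (divr_gt0 e0 c0);
  exists A => B /hA h.
rewrite -mulr_sumr -mulrBr Normc.normcM -[leRHS](divfK (lt0r_neq0 c0)) mulrC.
by rewrite ler_pM ?normc_ge0// lerDl.
Qed.

Lemma normc_conj (z : R[i]) : Normc.normc (conjC z) = Normc.normc z.
Proof. by apply: complexI; rewrite -!normcE norm_conjC. Qed.

Lemma normc_real (x : R) : Normc.normc x%:C = `|x|.
Proof. by rewrite /Normc.normc /= expr0n /= addr0 sqrtr_sqr. Qed.

Lemma sums_conj f l : sums f l -> sums (fun x => conjC (f x)) (conjC l).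
Proof.
move=> fl e /fl[A hA]; exists A => B /hA.
by rewrite -rmorph_sum -rmorphB normc_conj.
Qed.

Lemma sums_eq f g l : f =1 g -> sums f l -> sums g l.
Proof. by move=> /funext ->. Qed.

Lemma big_fset_split (A B : {fset Y}) : (A `<=` B)%fset -> exists C : seq Y,
  forall (V : nmodType) (F : Y -> V),
  \sum_(i <- B) F i = \sum_(i <- A) F i + \sum_(i <- C) F i.
Proof.
move=> AB; pose C := [seq x <- B | x \notin A].
have BAC : perm_eq B (A ++ C).
  apply: uniq_perm => [||x]; first exact: fset_uniq.
    rewrite cat_uniq fset_uniq filter_uniq ?fset_uniq// andbT /=.
    by apply/hasPn => x; rewrite mem_filter => /andP[].
  rewrite mem_cat mem_filter; case: (boolP (x \in A)) => //=.
  exact: (fsubsetP AB).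
by exists C => V F; rewrite (perm_big _ BAC) big_cat.
Qed.

Lemma ler_sum_fset a A B : (forall x, 0 <= a x) -> (A `<=` B)%fset ->
  \sum_(i <- A) a i <= \sum_(i <- B) a i.
Proof.
by move=> a0 /big_fset_split[C ->]; rewrite lerDl sumr_ge0.
Qed.

Lemma sums_nneg a (l : R) : (forall x, 0 <= a x) ->
  (forall A, \sum_(i <- A) a i <= l) ->
  (forall M, (forall A, \sum_(i <- A) a i <= M) -> l <= M) ->
  sums (fun x => (a x)%:C) l%:C.
Proof.
move=> a0 al lM e e0.
have [A hA] : exists A, l - e < \sum_(i <- A) a i.
  apply: contrapT => nA; have : l <= l - e.
    by apply: lM => A; rewrite leNgt; apply/negP => lA; apply: nA; exists A.
  by move: e0; lra.
exists A => B AB; rewrite -rmorph_sum -rmorphB normc_real.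
rewrite ler_norml; have := al B; have := ler_sum_fset a0 AB; move: hA.
lra.
Qed.

End Sums.

Section EllTwoHilbert.
Variables (R : realType) (Y : choiceType).
Implicit Types (f g h : ell2 R Y) (A B : {fset Y}).

Definition nsq f : R := fine (\esum_(x in [set: Y]) (Normc.normc (f x) ^+
  2)%:E).

Lemma fsbig_fset (a : Y -> \bar R) A :
  (\sum_(x \in [set` A]) a x = \sum_(x <- A) a x)%E.
Proof. by rewrite fsbig_finite//= set_fsetK. Qed.

Lemma esum_fset_le (a : Y -> R) (M : R) :
  (forall A, \sum_(i <- A) a i <= M) ->
  (\esum_(x in [set: Y]) (a x)%:E <= M%:E)%E.
Proof.
move=> aM; apply: ge_ereal_sup => _ [F [finF _] <-].
have [A ->] := (finite_fsetP).1 finF.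
by rewrite fsbig_fset sumEFin lee_fin.
Qed.

Lemma square_summable_bounded (f : Y -> R[i]^o) (M : R) :
  (forall A, \sum_(i <- A) Normc.normc (f i) ^+ 2 <= M) -> square_summable f.
Proof.
by move=> /esum_fset_le h; apply/asboolP; apply: le_lt_trans h _; rewrite ltry.
Qed.

Lemma nsq_fin f :
  (\esum_(x in [set: Y]) (Normc.normc (f x) ^+ 2)%:E)%E = (nsq f)%:E.
Proof.
rewrite fineK// ge0_fin_numE; first exact: (asboolP _ (ell2P f)).
by apply: esum_ge0 => x _; rewrite lee_fin exprn_ge0// normc_ge0.
Qed.

Lemma nsq_ge f A : \sum_(i <- A) Normc.normc (f i) ^+ 2 <= nsq f.
Proof.
rewrite -lee_fin -nsq_fin -sumEFin -fsbig_fset; apply: ereal_sup_ubound.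
by exists [set` A].
Qed.

Lemma nsq_le f (M : R) :
  (forall A, \sum_(i <- A) Normc.normc (f i) ^+ 2 <= M) -> nsq f <= M.
Proof. by move=> fM; rewrite -lee_fin -nsq_fin; exact: esum_fset_le. Qed.

Lemma nsq_ge0 f : 0 <= nsq f.
Proof. by have := nsq_ge f fset0; rewrite big_seq_fset0. Qed.

Lemma nsq_coord f x : Normc.normc (f x) ^+ 2 <= nsq f.
Proof. by have := nsq_ge f [fset x]%fset; rewrite big_seq_fset1. Qed.

Lemma sums_nsq f : sums (fun x => f x * conjC (f x)) (nsq f)%:C.
Proof.
apply: sums_eq (sums_nneg _ (nsq_ge f) (@nsq_le f)) => x /=.
  by rewrite -normCK normcE rmorphXn.
by rewrite exprn_ge0// normc_ge0.
Qed.

(* Polarization reduces convergence to that of the square norms. *)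
Lemma sums_ell2_dot f g : sums (fun x => f x * conjC (g x)) (ell2_dot f g).
Proof.
suff [l fl] : exists l, sums (fun x => f x * conjC (g x)) l.
  by rewrite /ell2_dot (sums_sum fl).
have h1 := sumsZ 4^-1 (sums_nsq (f + g)).
have h2 := sumsZ (- 4^-1) (sums_nsq (f - g)).
have h3 := sumsZ ('i * 4^-1) (sums_nsq (f + ('i : R[i]) *: g)).
have h4 := sumsZ (- 'i * 4^-1) (sums_nsq (f - ('i : R[i]) *: g)).
have h := sumsD (sumsD h1 h2) (sumsD h3 h4).
eexists; apply: sums_eq h => x /=.
change (4^-1 * ((f x + g x) * conjC (f x + g x)) +
  - 4^-1 * ((f x - g x) * conjC (f x - g x)) +
  ('i * 4^-1 * ((f x + 'i * g x) * conjC (f x + 'i * g x)) +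
   - 'i * 4^-1 * ((f x - 'i * g x) * conjC (f x - 'i * g x))) =
  f x * conjC (g x)).
have ii : 'i * 'i = -1 :> R[i] by rewrite -expr2 sqr_i.
rewrite !(rmorphD, rmorphN, rmorphM) /=.
have -> : conjC ('i : R[i]) = - 'i by apply/eqP;
  rewrite eq_complex /= oppr0 !eqxx.
move: (f x) (g x) (conjC (f x)) (conjC (g x)) => a b a' b'.
apply: (@mulfI _ 4); first by rewrite pnatr_eq0.
rewrite !mulrDr.
have e4 : 4 * 4^-1 = 1 :> R[i] by rewrite mulfV// pnatr_eq0.
transitivity (4 * 4^-1 * ((a + b) * (a' + b') - (a - b) * (a' - b') +
  'i * (a + 'i * b) * (a' - 'i * b') - 'i * (a - 'i * b) * (a' + 'i * b'))).
  by ring.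
rewrite e4 mul1r.
transitivity (2 * (a * b' + b * a') - 2 * ('i * 'i) * (a * b' - b * a'));
  first by ring.
by rewrite ii; ring.
Qed.

Lemma ell2_dotE f : ell2_dot f f = (nsq f)%:C.
Proof. exact: sums_unique (sums_ell2_dot f f) (sums_nsq f). Qed.

Lemma ell2_dot_linear_l h : GRing.linear_for *%R (fun f => ell2_dot f h).
Proof.
move=> c f g.
have H := sumsD (sumsZ c (sums_ell2_dot f h)) (sums_ell2_dot g h).
apply: (sums_unique (sums_ell2_dot _ _)); apply: sums_eq H => x.
change (c * (f x * conjC (h x)) + g x * conjC (h x) =
  (c * f x + g x) * conjC (h x)).
by rewrite mulrDl mulrA.
Qed.

Lemma ell2_dotC f g : ell2_dot f g = conjC (ell2_dot g f).
Proof.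
apply: (sums_unique (sums_ell2_dot _ _)); apply: sums_eq (sums_conj
  (sums_ell2_dot g f)).
by move=> x; rewrite rmorphM /= conjCK mulrC.
Qed.

Lemma ell2_dot_linear_r h : GRing.linear_for (conjC \; *%R) (ell2_dot h).
Proof.
move=> c f g; rewrite /= ell2_dotC ell2_dot_linear_l rmorphD rmorphM /=.
by rewrite -!ell2_dotC.
Qed.

Lemma ell2_dot_gt0 f : f != 0 -> 0 < ell2_dot f f.
Proof.
move=> f0; rewrite ell2_dotE ltcR lt_neqAle nsq_ge0 andbT eq_sym.
apply: contra_neq f0 => f0; apply: val_inj; apply/funext => x.
apply: Normc.eq0_normc; apply/eqP; rewrite -sqrf_eq0 eq_le.
by rewrite exprn_ge0 ?normc_ge0// andbT -f0 nsq_coord.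
Qed.

HB.instance Definition _ := bilinear_isBilinear.Build R[i] (ell2 R Y) (ell2 R Y)
  R[i]
  _ _ (@ell2_dot R Y) (ell2_dot_linear_l, ell2_dot_linear_r).
HB.instance Definition _ := isHermitianSesquilinear.Build R[i] (ell2 R Y) false
  conjC
  (@ell2_dot R Y) (fun f g => etrans (ell2_dotC f g) (esym (mul1r _))).
HB.instance Definition _ := isDotProduct.Build R[i] (ell2 R Y) (@ell2_dot R Y)
  ell2_dot_gt0.

Definition ell2_hdot : {dot ell2 R Y for conjC} := @ell2_dot R Y.

Lemma nsqZ (c : R[i]) f : nsq (c *: f) = Normc.normc c ^+ 2 * nsq f.
Proof.
apply: complexI; rewrite -ell2_dotE linearZl_LR linearZr_LR /= ell2_dotE.
by rewrite mulrA rmorphM /= rmorphXn /= -normcE normCK.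
Qed.

(** Termwise, from the square of [s * a - b]. The ratio of the norm of [g] to that of [f], taken as
    [s], gives the triangle inequality. *)
Lemma nsqD (s : R) f g : 0 < s -> nsq (f + g) <=
  (1 + s) * nsq f + (1 + s^-1) * nsq g.
Proof.
move=> s0; apply: nsq_le => A.
apply: (@le_trans _ _ (\sum_(i <- A) ((1 + s) * Normc.normc (f i) ^+ 2 +
    (1 + s^-1) * Normc.normc (g i) ^+ 2))); last first.
  rewrite big_split /= -!mulr_sumr; apply: lerD; (apply: ler_wpM2l;
    last exact: nsq_ge).
    by rewrite addr_ge0 ?ltW.
  by rewrite addr_ge0 ?invr_ge0 ?ltW.
apply: ler_sum => i _; have := le_normcD (f i) (g i).
have -> : (f + g) i = f i + g i by [].
have := normc_ge0 (f i); have := normc_ge0 (g i); have := normc_ge0 (f i + g i).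
move: (Normc.normc (f i + g i)) (Normc.normc (g i)) (Normc.normc (f i)) => c b a
  c0 b0 a0 cab.
apply: (@le_trans _ _ ((a + b) ^+ 2)); first by rewrite ler_pXn2r ?nnegrE
  ?addr_ge0//.
have : 0 <= s^-1 * (s * a - b) ^+ 2 by rewrite mulr_ge0 ?sqr_ge0// invr_ge0 ltW.
have -> : s^-1 * (s * a - b) ^+ 2 = s * a ^+ 2 - 2 * a * b + s^-1 * b ^+ 2.
  by field; rewrite gt_eqF.
lra.
Qed.

Definition ell2_nrm f : R := Num.sqrt (nsq f).

Lemma ell2_nrm_sq f : ell2_nrm f ^+ 2 = nsq f.
Proof. by rewrite sqr_sqrtr// nsq_ge0. Qed.

Lemma ell2_nrm_ge0 f : 0 <= ell2_nrm f. Proof. exact: sqrtr_ge0. Qed.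

Lemma ell2_nrm0_eq0 f : ell2_nrm f = 0 -> f = 0.
Proof.
move=> f0; apply/eqP/negPn/negP => /ell2_dot_gt0.
by rewrite ell2_dotE -ell2_nrm_sq f0 expr0n ltxx.
Qed.

Lemma ell2_nrmD f g : ell2_nrm (f + g) <= ell2_nrm f + ell2_nrm g.
Proof.
have [f0|f0] := eqVneq (ell2_nrm f) 0; first by rewrite (ell2_nrm0_eq0 f0) add0r
  lerDr ell2_nrm_ge0.
have [g0|g0] := eqVneq (ell2_nrm g) 0; first by rewrite (ell2_nrm0_eq0 g0) addr0
  lerDl ell2_nrm_ge0.
have fp : 0 < ell2_nrm f by rewrite lt_neqAle eq_sym f0 ell2_nrm_ge0.
have gp : 0 < ell2_nrm g by rewrite lt_neqAle eq_sym g0 ell2_nrm_ge0.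
rewrite -(@ler_pXn2r _ 2) ?nnegrE ?addr_ge0 ?ell2_nrm_ge0//.
rewrite ell2_nrm_sq; have := nsqD f g (divr_gt0 gp fp).
rewrite -!ell2_nrm_sq => /le_trans; apply; rewrite le_eqVlt; apply/orP; left;
  apply/eqP.
by field; rewrite f0 g0.
Qed.

Lemma ell2_nrmZ (c : R[i]) f : ell2_nrm (c *: f) = Normc.normc c * ell2_nrm f.
Proof.
by rewrite /ell2_nrm nsqZ sqrtrM ?exprn_ge0 ?normc_ge0// sqrtr_sqr ger0_norm
  ?normc_ge0.
Qed.

Let norm f : R[i] := (ell2_nrm f)%:C.

Let normD f g : norm (f + g) <= norm f + norm g.
Proof. by rewrite /norm -rmorphD lecR ell2_nrmD. Qed.

Let normZ (c : R[i]) f : norm (c *: f) = `|c| * norm f.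
Proof. by rewrite /norm ell2_nrmZ rmorphM normcE. Qed.

Let norm0_eq0 f : norm f = 0 -> f = 0.
Proof. by move=> /complexI/ell2_nrm0_eq0. Qed.

HB.instance Definition _ := Lmodule_isNormed.Build R[i] (ell2 R Y) normD normZ
  norm0_eq0.

Lemma ell2_normE f : `|f| = (ell2_nrm f)%:C. Proof. by []. Qed.

Lemma ell2_ball f g (r : R) : ball f r%:C g <-> ell2_nrm (f - g) < r.
Proof. by rewrite -ball_normE /= ell2_normE ltcR. Qed.

Lemma ell2_coord f x : Normc.normc (f x) <= ell2_nrm f.
Proof.
rewrite -(@ler_pXn2r _ 2) ?nnegrE ?ell2_nrm_ge0 ?normc_ge0// ell2_nrm_sq.
exact: nsq_coord.
Qed.

Lemma normc_Re (z : R[i]) : `|complex.Re z| <= Normc.normc z.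
Proof. by rewrite -lecR -normcE normc_ge_Re. Qed.

Lemma normc_Im (z : R[i]) : `|complex.Im z| <= Normc.normc z.
Proof.
case: z => a b /=; rewrite -sqrtr_sqr ler_sqrt ?addr_ge0 ?sqr_ge0//.
by rewrite lerDr sqr_ge0.
Qed.

Lemma normc_le_ReIm (z : R[i]) : Normc.normc z <=
  `|complex.Re z| + `|complex.Im z|.
Proof.
case: z => a b /=; rewrite -[leRHS]ger0_norm ?addr_ge0// -sqrtr_sqr ler_sqrt
  ?sqr_ge0//.
rewrite sqrrD !real_normK ?num_real// addrAC lerDl.
by rewrite mulrn_wge0// mulr_ge0.
Qed.

(** The pointwise limit [l] is also the limit in norm: on a given finite set [l] can be replaced by
    a member [g] of a set of small diameter, and the resulting bound does not depend on the finite
    set. *)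
Lemma ell2_complete (F : set_system (ell2 R Y)) : ProperFilter F ->
  cauchy F -> cvg F.
Proof.
move=> FF Fc.
have diam (r : R) : 0 < r -> exists2 A, F A & forall f g,
  A f -> A g -> ell2_nrm (f - g) < r.
  move=> r0; have /cauchy_ballP : cauchy F := Fc.
  have rC : 0 < r%:C :> R[i] by rewrite ltcR.
  move=> /(_ _ rC)[[P Q] [/= FP FQ] PQ]; exists (P `&` Q); first exact: filterI.
  by move=> f g [Pf _] [_ Qg]; apply/ell2_ball; apply: (PQ (f, g)).
have lim_real (p : ell2 R Y -> R) :
    (forall f g, `|p f - p g| <= ell2_nrm (f - g)) ->
    exists l, forall r, 0 < r -> F [set f | `|p f - l| < r].
  move=> plip; have /cvg_ex[l pl] : cvg (p @ F).
    apply: cauchy_cvg; apply: cauchy_exP => r r0.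
    have [A FA Ar] := diam r r0; have [f Af] := filter_ex FA.
    exists (p f); suff : F [set g | ball (p f) r (p g)] by [].
    apply: filterS FA => g Ag; rewrite -ball_normE /=.
    by apply: le_lt_trans (plip f g) _; exact: Ar.
  exists l => r r0; have : F [set f | ball l r (p f)] :=
    pl _ (nbhsx_ballx _ _ r0).
  by apply: filterS => f; rewrite -ball_normE /= distrC.
have limx x : exists l : R[i], forall r, 0 < r ->
  F [set f | Normc.normc (f x - l) < r].
  have [|a aP] := lim_real (fun f => complex.Re (f x)).
    move=> f g; apply: le_trans (ell2_coord _ x).
    by apply: le_trans (normc_Re _); rewrite raddfB.
  have [|b bP] := lim_real (fun f => complex.Im (f x)).
    move=> f g; apply: le_trans (ell2_coord _ x).
    by apply: le_trans (normc_Im _); rewrite raddfB.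
  exists (a +i* b) => r r0; have r2 : 0 < r / 2 by rewrite divr_gt0.
  apply: filterS2 (aP _ r2) (bP _ r2) => f /= fa fb.
  apply: le_lt_trans (normc_le_ReIm _) _; rewrite !raddfB /=.
  by rewrite [ltRHS]splitr ltrD.
have [l lP] := choice limx.
have close (r : R) : 0 < r -> exists2 A, F A & forall f B, A f ->
    \sum_(i <- B) Normc.normc (f i - l i) ^+ 2 <= 4 * r ^+ 2.
  move=> r0; have [A FA Ar] := diam r r0; exists A => // f B Af.
  (* With this [d], the terms [d ^+ 2] summed over [B] stay below [r ^+ 2]. *)
  pose d := r / (#|` B|.+1)%:R; have d0 : 0 < d by rewrite divr_gt0// ltr0n.
  have [g [Ag gl]] : exists g, A g /\ forall i,
    i \in B -> Normc.normc (g i - l i) < d.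
    have : F (A `&` [set g | forall i, i \in B -> Normc.normc (g i - l i) < d]).
      apply: filterI => //.
      suff : F [set g | forall i, i \in enum_fset B ->
        Normc.normc (g i - l i) < d] by [].
      elim: (enum_fset B) => [|i s IH]; first by apply: filterS FA => h _ i;
        rewrite in_nil.
      apply: filterS2 IH (lP i d d0) => h hs hi j.
      by rewrite inE => /predU1P[->|/hs].
    by move=> /filter_ex[g [? ?]]; exists g.
  apply: (@le_trans _ _ (\sum_(i <- B) (2 * Normc.normc ((f - g) i) ^+ 2 + 2 * d
    ^+ 2))).
    rewrite big_seq [leRHS]big_seq; apply: ler_sum => i /gl gi.
    have -> : (f - g) i = f i - g i by [].
    have := le_normcD (f i - g i) (g i - l i); rewrite addrA subrK.
    have := normc_ge0 (f i - g i); have := normc_ge0 (g i - l i).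
    have := normc_ge0 (f i - l i); move: gi.
    move: (Normc.normc (f i - g i)) (Normc.normc (g i - l i)) (Normc.normc (f i
      - l i)).
    move=> a b c bd c0 b0 a0 cab.
    have : c ^+ 2 <= (a + b) ^+ 2 by rewrite ler_pXn2r ?nnegrE ?addr_ge0.
    have : b ^+ 2 <= d ^+ 2 by rewrite ler_pXn2r ?nnegrE// ltW.
    by have := sqr_ge0 (a - b); nra.
  rewrite big_split /= -mulr_sumr.
  have h1 := nsq_ge (f - g) B; have h2 := Ar _ _ Af Ag.
  have h3 : nsq (f - g) <= r ^+ 2.
    by rewrite -ell2_nrm_sq ler_pXn2r ?nnegrE ?ell2_nrm_ge0 ?ltW.
  have h4 : \sum_(i <- B) (2 * d ^+ 2) <= 2 * r ^+ 2.
    rewrite big_const_seq count_predT iter_addr addr0 -[leLHS]mulr_natr -mulrA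
      ler_pM2l//.
    rewrite /d expr_div_n -mulrA ler_piMr ?exprn_ge0 ?ltW//.
    rewrite mulrC ltr_pdivrMr ?exprn_gt0 ?ltr0n// mul1r -natrX ltr_nat.
    by rewrite expnS expn1 leq_pmulr.
  by move: h1 h3 h4; lra.
have [A1 FA1 hA1] := close 1 ltr01; have [f0 Af0] := filter_ex FA1.
(* The bound is on [f0 - l], so this difference is the function known to be square summable; [l] is
   recovered as [f0 - d]. *)
pose d : ell2 R Y := Ell2 (@square_summable_bounded (fun x => f0 x - l x) _ (fun
  B => hA1 f0 B Af0)).
pose lim := f0 - d.
have limE x : lim x = l x.
  by have -> : lim x = f0 x - (f0 x - l x) by [];
    rewrite opprB addrCA subrr addr0.
apply/cvg_ex; exists lim; apply/cvgrPdist_le => e /gt0C[r r0 ->].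
have r2 : 0 < r / 2 by rewrite divr_gt0.
have [A FA hA] := close _ r2; apply: filterS FA => f Af.
have rr := ltW r0; rewrite distrC ell2_normE lecR -(@ler_pXn2r _ 2) ?nnegrE
  ?ell2_nrm_ge0//.
rewrite ell2_nrm_sq; apply: nsq_le => B; apply: le_trans.
  have e1 i : (f - lim) i = f i - l i by rewrite -limE.
  by under eq_bigr do rewrite e1; exact: hA.
by have -> : 4 * (r / 2) ^+ 2 = r ^+ 2 by field.
Qed.

HB.instance Definition _ := Uniform_isComplete.Build (ell2 R Y) ell2_complete.

Lemma ell2_hdot_norm f : ell2_hdot f f = `|f| ^+ 2.
Proof. by rewrite /ell2_hdot /= ell2_dotE ell2_normE -ell2_nrm_sq rmorphXn. Qed.

Definition ell2_hilbert : hilbert R := @Hilbert R (ell2 R Y) ell2_hdot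
  ell2_hdot_norm.

End EllTwoHilbert.

(** * Tensor products *)

Section SplitSums.
Variables (R : realType) (Y : choiceType).

Lemma normc_sum (I : Type) (r : seq I) (F : I -> R[i]) :
  Normc.normc (\sum_(i <- r) F i) <= \sum_(i <- r) Normc.normc (F i).
Proof.
elim: r => [|i r IH]; first by rewrite !big_nil Normc.normc0.
by rewrite !big_cons; apply: le_trans (le_normcD _ _) _; rewrite lerD2l.
Qed.

Lemma normc_prod (I : Type) (r : seq I) (F : I -> R[i]) :
  Normc.normc (\prod_(i <- r) F i) = \prod_(i <- r) Normc.normc (F i).
Proof.
elim: r => [|i r IH]; first by rewrite !big_nil Normc.normc1.
by rewrite !big_cons Normc.normcM IH.
Qed.

Lemma prod_close (I : eqType) (r : seq I) (l : I -> R[i]) (e : R) : 0 < e ->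
  exists2 d : R, 0 < d & forall z, (forall i, Normc.normc (z i - l i) <= d) ->
    Normc.normc (\prod_(i <- r) z i - \prod_(i <- r) l i) <= e.
Proof.
elim: r e => [|i r IH] e e0.
  by exists 1 => // z _; rewrite !big_nil subrr Normc.normc0 ltW.
set P := \prod_(j <- r) l j.
pose c := Normc.normc (l i) + 1; have c0 : 0 < c by rewrite ltr_wpDl ?normc_ge0.
pose k := Normc.normc P + 1; have k0 : 0 < k by rewrite ltr_wpDl ?normc_ge0.
pose e1 := Num.min 1 (e / 2 / c).
have e10 : 0 < e1 by rewrite lt_min ltr01 !divr_gt0.
have [d d0 dP] := IH e1 e10; exists (Num.min d (e / 2 / k)).
  by rewrite lt_min d0 !divr_gt0.
move=> z zl; rewrite !big_cons -/P.
have zP : Normc.normc (\prod_(j <- r) z j - P) <= e1.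
  by apply: dP => j; apply: le_trans (zl j) _; rewrite ge_min lexx.
have zi : Normc.normc (z i - l i) <= e / 2 / k.
  by apply: le_trans (zl i) _; rewrite ge_min lexx orbT.
have Pz : Normc.normc (\prod_(j <- r) z j) <= k.
  rewrite -[X in Normc.normc X](subrK P) addrC;
    apply: le_trans (le_normcD _ _) _.
  by rewrite lerD2l; apply: le_trans zP _; rewrite ge_min lexx.
have -> : z i * \prod_(j <- r) z j - l i * P =
    (z i - l i) * \prod_(j <- r) z j + l i * (\prod_(j <- r) z j - P) by ring.
apply: le_trans (le_normcD _ _) _; rewrite [leRHS]splitr !Normc.normcM lerD//.
  rewrite -[leRHS](divfK (lt0r_neq0 k0)); apply: ler_pM => //; exact: normc_ge0.
rewrite -[leRHS](divfK (lt0r_neq0 c0)) [leRHS]mulrC.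
apply: ler_pM; rewrite ?normc_ge0 ?lerDl//.
by apply: le_trans zP _; rewrite ge_min lexx orbT.
Qed.

Lemma ex_sup_sum (a : Y -> R) (M : R) : (forall x, 0 <= a x) ->
  (forall A : {fset Y}, \sum_(i <- A) a i <= M) ->
  exists s, (forall A : {fset Y}, \sum_(i <- A) a i <= s) /\
    sums (fun x => (a x)%:C) s%:C.
Proof.
move=> a0 aM; pose S := [set \sum_(i <- A) a i | A in [set: {fset Y}]].
have Ssup : has_sup S.
  split; first by exists (\sum_(i <- fset0) a i), fset0.
  by exists M => _ [A _ <-].
have le_s (A : {fset Y}) : \sum_(i <- A) a i <= sup S.
  by apply: ub_le_sup; [exact: Ssup.2|exists A].
exists (sup S); split=> //; apply: sums_nneg => // K aK.
by apply: ge_sup => [|_ [A _ <-]]; first exact: Ssup.1.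
Qed.

End SplitSums.

Section Boxes.
Variables (N : nat) (X : 'I_N -> choiceType).
Let Y : choiceType := (forall j, X j).

(** On finite boxes a sum of products factors. They also exhaust the product set: every finite
    subset lies in the box of its coordinate projections. *)
Lemma ex_box (A : forall j, {fset X j}) : exists B : {fset Y},
  (forall y : Y, y \in B <-> forall j, y j \in A j) /\
  forall (V : comPzSemiRingType) (F : forall j, X j -> V),
    \sum_(y <- B) \prod_(j < N) F j (y j) = \prod_(j < N) \sum_(x <- A j) F j x.
Proof.
pose T_ j : finType := A j; pose P := fprod T_.
pose emb (t : P) : Y := fun j => val (t j).
have emb_inj : injective emb.
  move=> t u tu; apply/fprodP => j; apply: val_inj.
  exact: (congr1 (fun y : Y => y j) tu).
exists (seq_fset tt (map emb (enum P))); split.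
  move=> y; rewrite seq_fsetE; split.
    by move=> /mapP[t _ ->] j; exact: valP.
  move=> yA; apply/mapP; exists (fprod_of_fun (fun j => FSetSub (yA j) : T_ j)).
    by rewrite mem_enum.
  by apply: functional_extensionality_dep => j; rewrite /emb fprodE.
move=> V F.
have -> : \prod_(j < N) \sum_(x <- A j) F j x = \prod_(j <
  N) \sum_(x : T_ j) F j (val x).
  by apply: eq_bigr => j _; rewrite (big_seq_fsetE _ _ xpredT (F j)).
pose G j : {ffun T_ j -> V} := [ffun x => F j (val x)].
have -> : \prod_(j < N) \sum_(x : T_ j) F j (val x) =
    \sum_(t : P) \prod_(j < N) G j (t j).
  transitivity (\prod_(j < N) \sum_(x in tagged_with T_ j) untag 0 (G j) x).
    by apply: eq_bigr => j _; rewrite -(big_tag (fun j (x : T_ j) => G j x));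
      apply: eq_bigr => x _; rewrite ffunE.
  by rewrite (@big_fprod _ _ _ _ _ _ _ G) bigA_distr_big_dep.
rewrite (perm_big (map emb (enum P))); last first.
  apply: uniq_perm => [||y]; [exact: fset_uniq| |by rewrite seq_fsetE].
  by rewrite map_inj_uniq// enum_uniq.
rewrite big_map big_enum; apply: eq_bigr => t _.
by apply: eq_bigr => j _; rewrite ffunE.
Qed.

Variable R : realType.

Lemma box_bound (a : forall j, X j -> R) (s : 'I_N -> R) (B : {fset Y}) :
  (forall j x, 0 <= a j x) -> (forall j (A : {fset X j}),
    \sum_(x <- A) a j x <= s j) ->
  \sum_(y <- B) \prod_(j < N) a j (y j) <= \prod_(j < N) s j.
Proof.
move=> a0 aS; have [B' [BB' B'E]] := ex_box (fun j => [fset y j | y in B]%fset).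
apply: (@le_trans _ _ (\sum_(y <- B') \prod_(j < N) a j (y j))).
  apply: ler_sum_fset; first by move=> y; apply: prodr_ge0.
  by apply/fsubsetP => y yB; apply/BB' => j; apply/imfsetP; exists y.
rewrite B'E; apply: ler_prod => j _; rewrite aS andbT.
by apply: sumr_ge0 => x _.
Qed.

(** A finite set [B] that contains a large box [B0] exceeds it by [C]. By [box_bound] the absolute
    values over [C] sum to at most the product of the full sums of absolute values minus the product
    of those over the sides of [B0], which is small. *)
Lemma prod_sums (f : forall j, X j -> R[i]) (l : 'I_N -> R[i]) :
  (forall j, sums (f j) (l j)) ->
  (forall j, exists M, forall A : {fset X j},
    \sum_(x <- A) Normc.normc (f j x) <= M) ->
  sums (fun y : Y => \prod_(j < N) f j (y j)) (\prod_(j < N) l j).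
Proof.
move=> fl fM e e0; have e2 : 0 < e / 2 by rewrite divr_gt0.
have /choice[s sP] j : exists s : R,
    (forall A : {fset X j}, \sum_(x <- A) Normc.normc (f j x) <= s) /\
    sums (fun x => (Normc.normc (f j x))%:C) s%:C.
  by have [M MP] := fM j; apply: ex_sup_sum MP => x; exact: normc_ge0.
have [d1 d10 d1P] := prod_close (enum 'I_N) l e2.
have [d2 d20 d2P] := prod_close (enum 'I_N) (fun j => (s j)%:C) e2.
have ex_A j : exists A : {fset X j}, Normc.normc (\sum_(x <- A) f j x - l j) <=
  d1 /\
    Normc.normc (\sum_(x <- A) (Normc.normc (f j x))%:C - (s j)%:C) <= d2.
  have [A AP] := fl j _ d10; have [B BP] := (sP j).2 _ d20.
  by exists (A `|` B)%fset; split; [apply: AP|apply: BP];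
    rewrite ?fsubsetUl ?fsubsetUr.
pose A j := xget fset0 [set A : {fset X j} | Normc.normc (\sum_(x <- A) f j x -
  l j) <= d1 /\
    Normc.normc (\sum_(x <- A) (Normc.normc (f j x))%:C - (s j)%:C) <= d2].
have AP j := xgetPex fset0 (ex_A j).
have [B0 [_ B0E]] := ex_box A.
exists B0 => B /big_fset_split[C CE].
have h1 := d1P (fun j => \sum_(x <- A j) f j x) (fun j => (AP j).1).
have h2 := d2P (fun j => \sum_(x <- A j) (Normc.normc (f j x))%:C) (fun j => (AP
  j).2).
rewrite !big_enum /= in h1 h2; rewrite -B0E in h1.
rewrite CE addrAC; apply: le_trans (le_normcD _ _) _.
rewrite [leRHS]splitr lerD//; apply: le_trans (normc_sum _ _) _.
have {}h2 : \prod_(j < N) s j - e / 2 <=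
    \prod_(j < N) \sum_(x <- A j) Normc.normc (f j x).
  move: h2; have -> : \prod_(j < N) \sum_(x <- A j) (Normc.normc (f j x))%:C =
      (\prod_(j < N) \sum_(x <- A j) Normc.normc (f j x))%:C.
    by rewrite rmorph_prod; apply: eq_bigr => j _; rewrite rmorph_sum.
  rewrite -rmorph_prod -rmorphB normc_real ler_norml lerBrDr => /andP[+ _].
  by rewrite addrC.
have := box_bound B (fun j x => normc_ge0 (f j x)) (fun j => (sP j).1).
rewrite (CE _ (fun y : Y => \prod_(j < N) Normc.normc (f j (y j)))).
rewrite (B0E _ (fun j x => Normc.normc (f j x))) => h3.
have -> : \sum_(y <- C) Normc.normc (\prod_(j < N) f j (y j)) =
    \sum_(y <- C) \prod_(j < N) Normc.normc (f j (y j)).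
  by apply: eq_bigr => y _; rewrite normc_prod.
by move: h2 h3; lra.
Qed.

Lemma square_summable_prod (x : forall j, ell2 R (X j)) :
  square_summable (fun y : Y => \prod_(j < N) x j (y j) : R[i]^o).
Proof.
apply: (@square_summable_bounded _ _ _ (\prod_(j < N) nsq (x j))) => B.
have := box_bound B (a := fun j t => Normc.normc (x j t) ^+ 2)
  (s := fun j => nsq (x j)) (fun j t => exprn_ge0 2 (normc_ge0 _)) (fun j =>
    @nsq_ge _ _ (x j)).
apply: le_trans; rewrite le_eqVlt; apply/orP; left; apply/eqP;
  apply: eq_bigr => y _.
by rewrite normc_prod prodrXl.
Qed.

Definition tensor (x : forall j, ell2 R (X j)) : ell2_hilbert R Y :=
  Ell2 (square_summable_prod x).

Lemma tensor_dotE (x y : forall j, ell2 R (X j)) :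
  ell2_dot (tensor x : ell2 R Y) (tensor y) = \prod_(j <
    N) ell2_dot (x j) (y j).
Proof.
apply: (sums_unique (sums_ell2_dot _ _)).
have := @prod_sums (fun j t => x j t * conjC (y j t)) (fun j => ell2_dot (x j)
  (y j)).
move=> /(_ (fun j => sums_ell2_dot _ _)) h; apply: sums_eq (h _) => [t|j].
  by rewrite big_split /= rmorph_prod.
exists (nsq (x j) + nsq (y j)) => A.
apply: (@le_trans _ _ (\sum_(t <- A) (Normc.normc (x j t) ^+ 2 + Normc.normc (y
  j t) ^+ 2))).
  apply: ler_sum => t _; rewrite Normc.normcM normc_conj.
  have := normc_ge0 (x j t); have := normc_ge0 (y j t).
  by move: (Normc.normc (x j t)) (Normc.normc (y j t)) => a b b0 a0;
    have := sqr_ge0 (a - b); nra.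
by rewrite big_split lerD// nsq_ge.
Qed.

Lemma tensor_multilinearE (j : 'I_N) (a : R[i]) (x y z : forall i,
  ell2 R (X i)) :
  (forall i, i != j -> x i = z i /\ y i = z i) -> z j = a *: x j + y j ->
  tensor z = a *: tensor x + tensor y.
Proof.
move=> xyz zj; apply: val_inj; apply/funext => t.
change (\prod_(i < N) z i (t i) = a * \prod_(i < N) x i (t i) + \prod_(i <
  N) y i (t i)).
have split_j (F : 'I_N -> R[i]) : \prod_(i < N) F i = F j * \prod_(i <
  N | i != j) F i.
  by rewrite (bigD1 j).
rewrite (split_j (fun i => z i (t i))) (split_j (fun i => x i (t i))).
rewrite (split_j (fun i => y i (t i))) zj.
have -> : \prod_(i < N | i != j) x i (t i) = \prod_(i < N | i != j) z i (t i).
  by apply: eq_bigr => i /xyz[-> _].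
have -> : \prod_(i < N | i != j) y i (t i) = \prod_(i < N | i != j) z i (t i).
  by apply: eq_bigr => i /xyz[_ ->].
change ((a * x j (t j) + y j (t j)) * \prod_(i < N | i != j) z i (t i) =
  a * (x j (t j) * \prod_(i < N | i != j) z i (t i)) + y j (t j) * \prod_(i <
    N | i != j) z i (t i)).
by ring.
Qed.

End Boxes.

(** * Approximation by finitely supported functions *)

Section Truncation.
Variables (R : realType) (Y : choiceType).

Lemma delta_square_summable (t : Y) :
  square_summable (fun x : Y => (x == t)%:R : R[i]^o).
Proof.
apply: (@square_summable_bounded _ _ _ 1) => A.
have h x : Normc.normc ((x == t)%:R : R[i]) ^+ 2 = (x == t)%:R :> R.
  by case: (x == t); rewrite ?Normc.normc1 ?Normc.normc0 ?expr1n ?expr0n.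
apply: (@le_trans _ _ (\sum_(x <- (A `|` [fset t])%fset) (x == t)%:R)).
  under eq_bigr do rewrite h.
  by apply: ler_sum_fset => [x|]; [exact: ler0n|exact: fsubsetUl].
have tA : t \in (A `|` [fset t])%fset by rewrite in_fsetU in_fset1 eqxx orbT.
by rewrite (bigD1_seq t tA (fset_uniq _)) /= eqxx big1 ?addr0// => x /negPf ->.
Qed.

Definition delta (t : Y) : ell2 R Y := Ell2 (delta_square_summable t).

Lemma sum_ell2E (I : Type) (r : seq I) (F : I -> ell2 R Y) x :
  (\sum_(i <- r) F i) x = \sum_(i <- r) F i x :> R[i].
Proof.
elim: r => [|i r IH]; first by rewrite !big_nil.
by rewrite !big_cons -IH.
Qed.

Lemma truncate_near (f : ell2 R Y) (e : R) : 0 < e -> exists A : {fset Y},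
  ell2_nrm (f - \sum_(t <- A) f t *: delta t) < e.
Proof.
move=> e0; have e2 : 0 < e ^+ 2 / 2 by rewrite divr_gt0 ?exprn_gt0.
have [A hA] : exists A : {fset Y}, nsq f - e ^+ 2 / 2 <
  \sum_(t <- A) Normc.normc (f t) ^+ 2.
  apply: contrapT => nA; suff : nsq f <= nsq f - e ^+ 2 / 2 by move: e2; lra.
  by apply: nsq_le => A; rewrite leNgt; apply/negP => lA; apply: nA; exists A.
exists A; set k := \sum_(t <- A) _.
have kE x : k x = if x \in A then f x else 0.
  rewrite /k sum_ell2E; under eq_bigr => t _.
    have -> : (f t *: delta t) x = f t * (x == t)%:R by []; over.
  case: ifPn => xA.
    rewrite (bigD1_seq x) ?fset_uniq//= eqxx mulr1 big1 ?addr0// => t.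
    by rewrite eq_sym => /negPf ->; rewrite mulr0.
  rewrite big_seq big1// => t tA; case: eqVneq => [xt|_]; last by rewrite mulr0.
  by rewrite xt tA in xA.
rewrite -(@ltr_pXn2r _ 2) ?nnegrE ?ell2_nrm_ge0 ?(ltW e0)// ell2_nrm_sq.
suff : nsq (f - k) <= e ^+ 2 / 2 by move: e2; lra.
apply: nsq_le => B; have := nsq_ge f (A `|` B)%fset.
have fk0 x : 0 <= Normc.normc ((f - k) x) ^+ 2 by rewrite exprn_ge0 ?normc_ge0.
have := ler_sum_fset fk0 (fsubsetUr A B).
have [C CE] := big_fset_split (fsubsetUl A B).
have fkE x : (f - k) x = if x \in A then 0 else f x.
  have -> : (f - k) x = f x - k x by [].
  by rewrite kE; case: ifP; rewrite ?subrr ?subr0.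
have A0 : \sum_(x <- A) Normc.normc ((f - k) x) ^+ 2 = 0.
  by rewrite big_seq big1// => x xA; rewrite fkE xA Normc.normc0 expr0n.
rewrite !CE A0 add0r.
have : \sum_(x <- C) Normc.normc ((f - k) x) ^+ 2 <=
  \sum_(x <- C) Normc.normc (f x) ^+ 2.
  apply: ler_sum => x _; rewrite fkE; case: ifP => // _.
  by rewrite Normc.normc0 expr0n exprn_ge0 ?normc_ge0.
by move: hA; lra.
Qed.

End Truncation.

Section TensorProduct.
Variables (R : realType) (N : nat) (X : 'I_N -> choiceType).
Let Y : choiceType := (forall j, X j).

Lemma tensor_delta (y : Y) : tensor (fun j => delta R (y j)) = delta R y.
Proof.
apply: val_inj; apply/funext => t.
change (\prod_(j < N) (t j == y j)%:R = (t == y)%:R :> R[i]).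
have [->|ty] := eqVneq t y; first by rewrite big1// => j _; rewrite eqxx.
have [j tyj] : exists j, t j != y j.
  apply: contrapT => nty; case/eqP: ty; apply: functional_extensionality_dep =>
    j.
  by apply/eqP/negPn/negP => tyj; apply: nty; exists j.
by rewrite (bigD1 j)//= (negPf tyj) mul0r.
Qed.

Lemma tensor_hilbert : @hilbert_tensor R N (fun j => ell2 R (X j))
  (fun j => @ell2_dot R (X j)) (ell2_hilbert R Y) (@tensor N X R).
Proof.
split.
- exact: tensor_multilinearE.
- exact: tensor_dotE.
- move=> O [f Of] Oop; have /nbhs_ballP[e e0 eO] : nbhs f O by exact:
  open_nbhs_nbhs.
  have [r r0 re] := gt0C e0; have [A fA] := truncate_near f r0.
  exists (\sum_(t <- A) f t *: delta R t); split.
    by apply: eO; rewrite re; apply/ell2_ball.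
  exists (size A), (fun i => f (tnth (in_tuple A) i)),
    (fun i j => delta R (tnth (in_tuple A) i j)).
  rewrite big_tnth; apply: eq_bigr => i _.
  by rewrite tensor_delta.
Qed.

End TensorProduct.

(** * Permutation representations on balls *)

Section PermutationRep.
Variables (R : realType) (U : metricType R) (Y : choiceType).
Variable act : isom U -> Y -> Y.
Hypothesis act1 : forall y, act 1%g y = y.
Hypothesis actM : forall g h y, act (g * h)%g y = act g (act h y).
Hypothesis act_near : forall (g : isom U) y,
  nbhs g [set h : isom U | act h y = act g y].

Lemma actK g : cancel (act g) (act g^-1%g).
Proof. by move=> y; rewrite -actM mulVg act1. Qed.

Lemma actVK g : cancel (act g^-1%g) (act g).
Proof. by move=> y; rewrite -actM mulgV act1. Qed.

Lemma shift_square_summable (g : isom U) (f : ell2 R Y) :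
  square_summable (fun y => f (act g^-1%g y)).
Proof.
apply: (@square_summable_bounded _ _ _ (nsq f)) => A.
have inj : injective (act g^-1%g) by exact: can_inj (actVK g).
have := nsq_ge f (act g^-1%g @` A)%fset.
by rewrite big_imfset//= => x y _ _; exact: inj.
Qed.

Definition shift (g : isom U) (f : ell2 R Y) : ell2 R Y :=
  Ell2 (shift_square_summable g f).

Lemma shift_linear g : linear (shift g).
Proof. by move=> c f k; apply: val_inj. Qed.

HB.instance Definition _ g :=
  GRing.isLinear.Build R[i] (ell2 R Y) (ell2 R Y) *:%R (shift g) (shift_linear
    g).

Lemma shiftM g h f : shift (g * h)%g f = shift g (shift h f).
Proof. by apply: val_inj; apply/funext => y; rewrite /= invgM actM. Qed.

Lemma shift1 f : shift 1%g f = f.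
Proof. by apply: val_inj; apply/funext => y; rewrite /= invg1 act1. Qed.

Lemma shift_bij g : bijective (shift g).
Proof.
by exists (shift g^-1%g) => f; rewrite -shiftM ?mulVg ?mulgV shift1.
Qed.

Lemma sums_reindex (f : Y -> R[i]) l (s t : Y -> Y) : cancel s t ->
  cancel t s ->
  sums f l -> sums (fun y => f (s y)) l.
Proof.
move=> st ts fl e /fl[A hA]; exists (t @` A)%fset => B tAB.
have := hA (s @` B)%fset; rewrite big_imfset /=; last first.
  by move=> x y _ _; exact: (can_inj st).
apply; apply/fsubsetP => x xA; apply/imfsetP; exists (t x) => //=.
by apply: (fsubsetP tAB); apply/imfsetP; exists x.
Qed.

Lemma shift_dot g f h : ell2_dot (shift g f) (shift g h) = ell2_dot f h.
Proof.
apply: (sums_unique (sums_ell2_dot _ _)).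
exact: sums_reindex (actVK g) (actK g) (sums_ell2_dot f h).
Qed.

Lemma shift_nrm g f : ell2_nrm (shift g f) = ell2_nrm f.
Proof.
rewrite /ell2_nrm; congr Num.sqrt; apply: complexI.
by rewrite -!ell2_dotE shift_dot.
Qed.

Lemma shift_delta_sum g (A : {fset Y}) (c : Y -> R[i]) :
  shift g (\sum_(t <- A) c t *: delta R t) =
    \sum_(t <- A) c t *: delta R (act g t).
Proof.
rewrite linear_sum; apply: eq_bigr => t _; rewrite linearZ; congr (_ *: _).
apply: val_inj; apply/funext => y /=; congr (_%:R); congr (nat_of_bool _).
by apply/eqP/eqP => [<-|->]; rewrite ?actVK ?actK.
Qed.

(** The action on a finite set of points is locally constant in [g], so the shift of a finitely
    supported function is too; the general case follows because shifts are isometric. *)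
Lemma shift_continuous f : continuous (fun g => shift g f).
Proof.
move=> g; have gF : Filter (nbhs g) := nbhs_filter g.
apply/cvgrPdist_lt => e /gt0C[r r0 ->].
have r2 : 0 < r / 2 by rewrite divr_gt0.
have [A] := truncate_near f r2; set k := \sum_(t <- A) _ => fk.
have : nbhs g [set h : isom U | forall y, y \in enum_fset A ->
  act h y = act g y].
  elim: (enum_fset A) => [|y s IH]; first by apply: (@filterS _ _ gF _ _ _
    filterT) => h _ y.
  apply: filterS2 IH (act_near g y) => h hs hy z.
  by rewrite inE => /predU1P[->|/hs].
apply: filterS => h hA; rewrite ell2_normE ltcR.
have hk : shift h k = shift g k.
  rewrite !shift_delta_sum big_seq [RHS]big_seq; apply: eq_bigr => t tA.
  by rewrite (hA t tA).
have -> : shift g f - shift h f = shift g (f - k) + shift h (k - f).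
  have lB g' a b : shift g' (a - b) = shift g' a - shift g' b by exact: linearB.
  by rewrite !lB hk addrA subrK.
apply: le_lt_trans (ell2_nrmD _ _) _; rewrite [ltRHS]splitr !shift_nrm.
rewrite ltrD//; have -> : k - f = (-1 : R[i]) *: (f - k) by rewrite scaleN1r
  opprB.
by rewrite ell2_nrmZ normcN Normc.normc1 mul1r.
Qed.

Definition shift_rep : unitary_rep U (ell2_hilbert R Y) :=
  @UnitaryRep R U (ell2_hilbert R Y) (fun g => shift g) shift_bij shift_dot
    shiftM
    shift_continuous.

End PermutationRep.

(** * Cuts and perfect pairs *)

Section PerfectPairs.
Variables (R : realType) (L : set R) (U : metricType R).
Hypothesis L_pos : forall r, L r -> 0 < r.
Hypothesis HU : urysohn L U.

Lemma ex_increasing (S : set R) : S !=set0 -> (forall s, S s -> exists2 t,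
  S t & s < t) ->
  has_ubound S -> exists u : R^nat,
    [/\ forall n, S (u n), increasing_seq u & u @ \oo --> sup S].
Proof.
move=> [s0 Ss0] nomax ubS; have hS : has_sup S by split; [exists s0|].
have step (sn : {s | S s} * nat) : exists t : {s | S s},
    sval sn.1 < sval t /\ sup S - sn.2.+1%:R^-1 < sval t.
  case: sn => [[s Ss] n] /=; have [t St st] := nomax s Ss.
  have n0 : 0 < n.+1%:R^-1 :> R by rewrite invr_gt0 ltr0n.
  have [t' St' tt'] := sup_adherent n0 hS.
  have [tt|tt] := leP t t'.
    by exists (exist _ t' St'); split=> //=; exact: lt_le_trans tt.
  by exists (exist _ t St); split=> //=; exact: lt_trans tt.
have [f fP] := choice step.
pose v := fix v n : {s | S s} := if n is m.+1 then f (v m,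
  m) else exist _ s0 Ss0.
exists (fun n => sval (v n)); split.
- by move=> n; exact: svalP.
- by apply/increasing_seqP => n; have [] := fP (v n, n).
- rewrite -cvg_shiftS; apply/cvgrPdist_lt => e e0; near=> n.
  have vS : sval (v n.+1) <= sup S.
    by apply: ub_le_sup => //; exact: (svalP (v n.+1)).
  rewrite ger0_norm ?subr_ge0// ltrBlDr -ltrBlDl.
  have [_ /=] := fP (v n, n); apply: le_lt_trans; rewrite lerD2l lerN2 ltW//.
  by near: n; exact: (near_infty_natSinv_lt (PosNum e0)).
Unshelve. all: by end_near. Qed.

(* Only the trace of the cut on the spectrum matters; it is empty, or has a
   largest element, or is exhausted by an increasing sequence,
     or is unbounded. *)
Lemma perfect_cut (D : set R) : cut D -> exists p, perfect_pair L p /\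
  forall x : U, mball p.1 x p.2 = [set y | D (mdist x y)].
Proof.
move=> cD; pose S := [set s | L s /\ D s].
have dS (x y : U) : D (mdist x y) -> mdist x y = 0 \/ S (mdist x y).
  move=> Dxy; have [|xy] := eqVneq (mdist x y) 0; first by left.
  by right; split=> //; exact: (mdist_in_spectrum HU xy).
have [S0|S0] := pselect (S !=set0); last first.
  (* The balls are single points. The cut contains some [e > 0] but no distance, so the spectrum
     stays away from 0, as [plus0] requires. *)
  exists (Closed, 0%:E); split=> /=.
    right; split=> // L0; have [_ [e e0 De]] := cD.
    have [|y [y0 Ly /= ye]] := L0 (ball 0 e); first exact: nbhsx_ballx.
    apply: S0; exists y; split=> //; apply: cut_le cD _ De; move: ye;
      rewrite -ball_normE /= sub0r normrN.
    by rewrite gtr0_norm ?L_pos// => /ltW.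
  move=> x; apply/seteqP; split=> y /=; rewrite lee_fin.
    move=> xy; apply: cut_le cD _ (cut0 cD); exact: xy.
  by move=> /dS[->//|Sxy]; case: S0; exists (mdist x y).
have [[m [Lm Dm] mmax]|nomax] := pselect (exists2 m, S m & forall s,
  S s -> s <= m).
  exists (Closed, m%:E); split; first by left.
  move=> x; apply/seteqP; split=> y /=; rewrite lee_fin.
    by move=> xy; exact: (cut_le cD xy Dm).
  by move=> /dS[->|/mmax//]; rewrite ltW// L_pos.
have {}nomax s : S s -> exists2 t, S t & s < t.
  move=> Ss; apply: contrapT => ns; apply: nomax; exists s => // t St.
  by rewrite leNgt; apply/negP => st; apply: ns; exists t.
have [ubS|nubS] := pselect (has_ubound S); last first.
  (* A cut that contains arbitrarily large distances is the whole line, and its ball is the whole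
     space. *)
  have Dall t : D t.
    apply: contrapT => nDt; apply: nubS; exists t => s [_ Ds].
    exact/ltW/(cut_lt cD Ds nDt).
  exists (Open, +oo%E); split=> /=.
    by apply: contra_not nubS => -[b bL]; exists b => s [Ls _]; exact: bL.
  by move=> x; apply/seteqP; split=> y //= _; rewrite ltry.
have [u [uS u_incr u_lim]] := ex_increasing S0 nomax ubS.
exists (Open, (sup S)%:E); split.
  by exists u; split=> // n; have [] := uS n.
have hS : has_sup S by split.
have ltS s : S s -> s < sup S.
  by move=> /nomax[t St st]; apply: lt_le_trans st _; exact: ub_le_sup.
move=> x; apply/seteqP; split=> y /=; rewrite lte_fin.
  move=> xy; have := sup_adherent (_ : 0 < sup S - mdist x y) hS.
  rewrite subr_gt0 => /(_ xy)[s [_ Ds]]; rewrite subKr => xs.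
  exact: (cut_le cD (ltW xs) Ds).
move=> /dS[->|/ltS//]; have [s Ss] := S0.
by apply: lt_trans (ltS s Ss); apply: L_pos; have [] := Ss.
Qed.

End PerfectPairs.

(** * The representation on tuples of balls *)

Section BallAction.
Variables (R : realType) (U : metricType R) (N : nat).
Variable p : 'I_N -> ball_kind * \bar R.

Definition ball_tuple : choiceType := (forall j, @Xi R U (p j)).

Definition ball_act (g : isom U) (y : ball_tuple) : ball_tuple :=
  fun j => Xi_act g (y j).

Lemma ball_act1 y : ball_act 1%g y = y.
Proof.
apply: functional_extensionality_dep => j; apply: val_inj => /=.
exact: image_id.
Qed.

Lemma ball_actM g h y : ball_act (g * h)%g y = ball_act g (ball_act h y).
Proof.
apply: functional_extensionality_dep => j; apply: val_inj => /=.
by rewrite image_comp.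
Qed.

Variables (L : set R) (D : 'I_N -> set R).
Hypothesis HU : urysohn L U.
Hypothesis cD : forall j, cut (D j).
Hypothesis pD : forall j (x : U), mball (p j).1 x (p j).2 =
  [set y | D j (mdist x y)].

Lemma mball_eq j (x y : U) : D j (mdist x y) ->
  mball (p j).1 x (p j).2 = mball (p j).1 y (p j).2.
Proof.
move=> xy; rewrite !pD; apply/seteqP; split=> z /= h.
  by apply: (cut_mdist HU (cD j)) h; rewrite metric_sym.
exact: (cut_mdist HU (cD j)) h.
Qed.

Lemma ball_act_near g y : nbhs g [set h : isom U | ball_act h y = ball_act g y].
Proof.
have gF : Filter (nbhs g) := nbhs_filter g.
have near_j j : nbhs g [set h : isom U | Xi_act h (y j) = Xi_act g (y j)].
  have [_ [e e0 De]] := cD j.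
  have [x _ xy] : range (fun x : U => mball (p j).1 x (p j).2) (val (y j)).
    exact: set_mem (valP (y j)).
  have : nbhs g ((fun h : isom U => h x) @^-1` ball (g x) e).
    by apply: eval_isom_continuous; exact: nbhsx_ballx.
  apply: filterS => h; rewrite /= ballEmdist /= => ghe; apply: val_inj => /=.
  rewrite -xy !isom_mball; symmetry; apply: mball_eq.
  exact: (cut_le (cD j) (ltW ghe) De).
have : nbhs g [set h : isom U | forall j, j \in enum 'I_N ->
  Xi_act h (y j) = Xi_act g (y j)].
  elim: (enum 'I_N) => [|j s IH]; first by apply: (@filterS _ _ gF _ _ _
    filterT) => h _ j.
  apply: filterS2 IH (near_j j) => h hs hj k.
  by rewrite inE => /predU1P[->|/hs].
apply: filterS => h hE; apply: functional_extensionality_dep => j.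
by apply: hE; rewrite mem_enum.
Qed.

Definition ball_rep : unitary_rep U (ell2_hilbert R ball_tuple) :=
  shift_rep ball_act1 ball_actM ball_act_near.

Lemma ball_rep_tensor : @tensor_of_ell2 R U N p (ell2_hilbert R ball_tuple)
  (@tensor N (fun j => @Xi R U (p j)) R) ball_rep.
Proof.
split; first exact: tensor_hilbert.
by move=> g x; apply: val_inj.
Qed.

End BallAction.

(** * Frames *)

(** If all the eigenvalues vanished, the characteristic polynomial would be a power of ['X], and its
    coefficient that carries the trace would be 0. *)
Lemma ex_nonzero_eigenvalue (F : closedFieldType) n (M : 'M[F]_n) : \tr M != 0
  ->
  exists (v : 'rV[F]_n) (l : F), [/\ v != 0, l != 0 & v *m M = l *: v].
Proof.
case: n M => [|n] M trM; first by rewrite /mxtrace big_ord0 eqxx in trM.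
have [r rE] := closed_field_poly_normal (char_poly M).
have monM := char_poly_monic M; move: rE; rewrite (monicP monM) scale1r => rE.
have [/allP r0|] := boolP (all (fun z => z == 0) r).
  have sr : size r = n.+1.
    by have := size_char_poly M; rewrite rE size_prod_XsubC => -[].
  have charE : char_poly M = 'X^(n.+1).
    rewrite rE big_seq (eq_bigr (fun=> 'X)); last first.
      by move=> z /r0/eqP ->; rewrite subr0.
    by rewrite -big_seq big_const_seq count_predT sr iter_mulr_1.
  have := char_poly_trace M (ltn0Sn n); rewrite charE coefXn /=.
  by rewrite (ltn_eqF (ltnSn n)) => /eqP; rewrite eq_sym oppr_eq0 (negPf trM).
move=> /allPn[l lr l0]; have : root (char_poly M) l.
  by rewrite rE root_prod_XsubC.
rewrite -eigenvalue_root_char => /eigenvalueP[v vM v0].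
by exists v, l.
Qed.

Lemma mul_le_half_sqr (R : realFieldType) (p q k : R) : 0 <= k ->
  p * q * k <= k / 2 * p ^+ 2 + k / 2 * q ^+ 2.
Proof. by move=> k0; have := mulr_ge0 k0 (sqr_ge0 (p - q)); rewrite sqrrB;
  lra. Qed.

Section Frame.
Variables (R : realType) (H : hilbert R) (Y : choiceType) (e : Y -> H).
Variables (c : R) (m : nat) (cls : Y -> seq Y).
Hypothesis e_le : forall y, nrm (e y) <= c.
Hypothesis cls_size : forall y, (size (cls y) <= m)%N.
Hypothesis cls_dot : forall y z, dot (e y) (e z) != 0 -> z \in cls y.

Lemma dot_suml (I : Type) (r : seq I) (F : I -> H) v :
  dot (\sum_(i <- r) F i) v = \sum_(i <- r) dot (F i) v.
Proof.
elim: r => [|i r IH]; first by rewrite !big_nil dot0l.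
by rewrite !big_cons dotDl IH.
Qed.

Lemma dot_sumr (I : Type) (r : seq I) (F : I -> H) v :
  dot v (\sum_(i <- r) F i) = \sum_(i <- r) dot v (F i).
Proof.
elim: r => [|i r IH]; first by rewrite !big_nil dot0r.
by rewrite !big_cons dotDr IH.
Qed.

Let chi y z : R := (dot (e y) (e z) != 0)%:R.

Let chiC y z : chi y z = chi z y.
Proof.
rewrite /chi; congr (nat_of_bool _)%:R.
by rewrite (dotC (e y)) conjC_eq0.
Qed.

Let chi_sum y (B : {fset Y}) : \sum_(z <- B) chi y z <= m%:R.
Proof.
rewrite /chi -natr_sum ler_nat; apply: leq_trans (cls_size y).
rewrite -big_mkcond /= sum1_count -size_filter; apply: uniq_leq_size.
  by rewrite filter_uniq// fset_uniq.
by move=> z; rewrite mem_filter => /andP[/cls_dot].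
Qed.

(** Each nonzero term is at most [c ^+ 2 / 2] times the sum of the squared moduli of [a y] and
    [a z], and each index meets at most [m] indices in nonzero terms. *)
Lemma synthesis_bound (a : Y -> R[i]) (B : {fset Y}) :
  nrm (\sum_(y <- B) a y *: e y) ^+ 2 <=
  m%:R * c ^+ 2 * \sum_(y <- B) Normc.normc (a y) ^+ 2.
Proof.
set w := \sum_(y <- B) _; set s := \sum_(y <- B) _.
have ww : dot w w = \sum_(y <- B) \sum_(z <- B) a y * conjC (a z) * dot (e y) (e
  z).
  rewrite dot_suml; apply: eq_bigr => y _; rewrite dotZl dot_sumr mulr_sumr.
  by apply: eq_bigr => z _; rewrite dotZr mulrA.
have -> : nrm w ^+ 2 = Normc.normc (dot w w).
  by rewrite dotvv normc_real ger0_norm// exprn_ge0// nrm_ge0.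
have c0 (y : Y) : 0 <= c by apply: le_trans (e_le y); exact: nrm_ge0.
apply: (@le_trans _ _ (\sum_(y <- B) \sum_(z <- B)
   (chi y z * (c ^+ 2 / 2 * Normc.normc (a y) ^+ 2) +
    chi z y * (c ^+ 2 / 2 * Normc.normc (a z) ^+ 2)))).
  rewrite ww; apply: le_trans (normc_sum _ _) _; apply: ler_sum => y _.
  apply: le_trans (normc_sum _ _) _; apply: ler_sum => z _.
  rewrite (chiC z) -mulrDr /chi; have [yz|yz] := eqVneq (dot (e y) (e z)) 0.
    by rewrite yz mulr0 Normc.normc0 mul0r.
  rewrite mul1r !Normc.normcM normc_conj.
  have cc : Normc.normc (dot (e y) (e z)) <= c ^+ 2.
    apply: le_trans (cauchy_schwarz _ _) _; rewrite expr2.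
    by apply: ler_pM; rewrite ?nrm_ge0.
  apply: (@le_trans _ _ (Normc.normc (a y) * Normc.normc (a z) * c ^+ 2)).
    by apply: ler_wpM2l cc; rewrite mulr_ge0 ?normc_ge0.
  by apply: mul_le_half_sqr; rewrite sqr_ge0.
have half : \sum_(y <- B) \sum_(z <- B) chi y z * (c ^+ 2 / 2 * Normc.normc (a
  y) ^+ 2) <=
    m%:R * (c ^+ 2 / 2 * s).
  rewrite /s !mulr_sumr; apply: ler_sum => y _; rewrite -mulr_suml.
  apply: ler_wpM2r (chi_sum y B).
  by rewrite mulr_ge0 ?sqr_ge0 ?exprn_ge0 ?normc_ge0// divr_ge0 ?sqr_ge0.
have -> : m%:R * c ^+ 2 * s = m%:R * (c ^+ 2 / 2 * s) + m%:R * (c ^+ 2 / 2 * s).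
  by field.
under eq_bigr do rewrite big_split; rewrite big_split lerD//=.
by rewrite exchange_big.
Qed.

(** Dual to [synthesis_bound]: the sum [s] equals [dot v w], so [s <= nrm v * nrm w], while the
    square of [nrm w] is at most [m%:R * c ^+ 2 * s]. *)
Lemma bessel v (B : {fset Y}) :
  \sum_(y <- B) Normc.normc (dot v (e y)) ^+ 2 <= m%:R * c ^+ 2 * nrm v ^+ 2.
Proof.
set s := \sum_(y <- B) _; set w := \sum_(y <- B) dot v (e y) *: e y.
have s0 : 0 <= s by apply: sumr_ge0 => y _; rewrite exprn_ge0 ?normc_ge0.
have vw : dot v w = s%:C.
  rewrite dot_sumr rmorph_sum; apply: eq_bigr => y _.
  by rewrite dotZr mulrC -normCK normcE rmorphXn.
have sw : s <= nrm v * nrm w.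
  by have := cauchy_schwarz v w; rewrite vw normc_real ger0_norm.
have ws := synthesis_bound (fun y => dot v (e y)) B; rewrite -/w -/s in ws.
have mc0 : 0 <= m%:R * c ^+ 2 by rewrite mulr_ge0 ?sqr_ge0.
have [->|s1] := eqVneq s 0; first by rewrite mulr_ge0 ?sqr_ge0.
have sp : 0 < s by rewrite lt_neqAle eq_sym s1.
rewrite -(ler_pM2r sp).
apply: (@le_trans _ _ ((nrm v * nrm w) ^+ 2)).
  by rewrite -expr2 ler_pXn2r ?nnegrE ?mulr_ge0 ?nrm_ge0.
by rewrite exprMn [leRHS]mulrAC [leLHS]mulrC ler_wpM2r ?sqr_ge0.
Qed.

Lemma analysis_square_summable v :
  square_summable (fun y => dot v (e y) : R[i]^o).
Proof. exact: square_summable_bounded (bessel v). Qed.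

Definition analysis v : ell2 R Y := Ell2 (analysis_square_summable v).

Lemma analysis_linear : linear analysis.
Proof.
move=> k u v; apply: val_inj; apply/funext => y.
change (dot (k *: u + v) (e y) = k * dot u (e y) + dot v (e y)).
by rewrite dotDl dotZl.
Qed.

HB.instance Definition _ :=
  GRing.isLinear.Build R[i] H (ell2 R Y) *:%R analysis analysis_linear.

Lemma analysis_nrm v : ell2_nrm (analysis v) ^+ 2 <= m%:R * c ^+ 2 * nrm v ^+ 2.
Proof. by rewrite ell2_nrm_sq; apply: nsq_le => B; exact: bessel. Qed.

End Frame.

Lemma sums_finite (R : realType) (Y : choiceType) (f : Y ->
  R[i]) (Q : {fset Y}) :
  (forall y, y \notin Q -> f y = 0) -> sums f (\sum_(y <- Q) f y).
Proof.
move=> fQ r r0; exists Q => B QB; suff -> : \sum_(y <- B) f y =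
  \sum_(y <- Q) f y.
  by rewrite subrr Normc.normc0 ltW.
by rewrite [RHS](big_fset_incl _ QB) // => y _ /fQ.
Qed.

(** * From a Bessel family to an embedding *)

Section Embedding.
Variables (R : realType) (U : metricType R) (H : hilbert R) (pi : unitary_rep U
  H).
Hypothesis pi_irr : irreducible pi.
Variables (Y : choiceType) (act : isom U -> Y -> Y).
Hypothesis act1 : forall y, act 1%g y = y.
Hypothesis actM : forall g h y, act (g * h)%g y = act g (act h y).
Hypothesis act_near : forall (g : isom U) y,
  nbhs g [set h : isom U | act h y = act g y].
Variables (e : Y -> H) (Q : {fset Y}) (c : R) (m : nat) (cls : Y -> seq Y).
Hypothesis e_le : forall y, nrm (e y) <= c.
Hypothesis cls_size : forall y, (size (cls y) <= m)%N.
Hypothesis cls_dot : forall y z, dot (e y) (e z) != 0 -> z \in cls y.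
Hypothesis e_act : forall g y, e (act g y) = pi g (e y).
Hypothesis Q_dot : forall y z, y \in Q -> dot (e y) (e z) != 0 -> z \in Q.
Hypothesis e_neq0 : exists2 y, y \in Q & e y != 0.

Let J := analysis e_le cls_size cls_dot.

Lemma analysis_act g v : J (pi g v) = shift act1 actM g (J v).
Proof.
apply: val_inj; apply/funext => y /=.
rewrite e_act; transitivity (dot (pi g v) (pi g (pi g^-1%g (e y))));
  last exact: rep_dot.
by rewrite -repM mulgV rep1.
Qed.

(* The analysis operator is a multiple of an isometry, because its Gram matrix
   on the finite set [Q] has a nonzero eigenvalue and [pi] is irreducible. *)
Lemma analysis_scalar : exists2 l : R[i], 0 < l &
  forall v w, ell2_dot (J v) (J w) = l * dot v w.
Proof.
pose k := size Q; pose q (i : 'I_k) : Y := tnth (in_tuple Q) i.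
have sumQ (V : nmodType) (F : Y -> V) : \sum_(y <- Q) F y = \sum_(i <
  k) F (q i).
  by rewrite big_tnth.
pose M : 'M[R[i]]_k := \matrix_(j, i) dot (e (q j)) (e (q i)).
have trM : \tr M != 0.
  rewrite /mxtrace; under eq_bigr do rewrite mxE.
  rewrite -(sumQ _ (fun y => dot (e y) (e y))); have [y0 y0Q ey0] := e_neq0.
  rewrite (bigD1_seq y0) ?fset_uniq//= gt_eqF// ltr_wpDr//.
    by apply: sumr_ge0 => y _; rewrite dotvv ler0c exprn_ge0 ?nrm_ge0.
  by rewrite dotvv ltcR exprn_gt0// nrm_gt0.
have [x [l [x0 l0 xM]]] := ex_nonzero_eigenvalue trM.
(* An eigenvector, with eigenvalue [l], of the adjoint of [J] composed with [J]: the coefficients of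
   [w] are those of [x] times [l] on [Q], and they vanish off [Q] because [Q] is closed under
   non-orthogonality. *)
pose w := \sum_(j < k) x 0 j *: e (q j).
have wq i : dot w (e (q i)) = l * x 0 i.
  have := congr1 (fun A : 'rV_k => A 0 i) xM; rewrite !mxE => <-.
  by rewrite dot_suml; apply: eq_bigr => j _; rewrite dotZl mxE.
have qQ i : q i \in Q by exact: mem_tnth.
have wQ y : y \notin Q -> dot w (e y) = 0.
  move=> yQ; rewrite dot_suml big1// => j _; rewrite dotZl.
  have [->|qy] := eqVneq (dot (e (q j)) (e y)) 0; first by rewrite mulr0.
  by rewrite (Q_dot (qQ j) qy) in yQ.
have Jw v : ell2_dot (J w) (J v) = l * dot w v.
  apply: (sums_unique (sums_ell2_dot _ _)).
  have -> : l * dot w v = \sum_(y <- Q) dot w (e y) * conjC (dot v (e y)).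
    rewrite sumQ dot_suml mulr_sumr; apply: eq_bigr => i _.
    by rewrite wq -dotC dotZl mulrA.
  by apply: sums_finite => y /wQ wy; rewrite /= wy mul0r.
have w0 : w != 0.
  apply: contra_neq x0 => w0; apply/rowP => i; rewrite mxE.
  by have := wq i; rewrite w0 dot0l => /esym/eqP;
    rewrite mulf_eq0 (negPf l0) => /eqP.
have l_gt0 : 0 < l.
  rewrite lt_neqAle eq_sym l0 /=.
  have ww : 0 < dot w w by rewrite dotvv ltcR exprn_gt0// nrm_gt0.
  by rewrite -(pmulr_lge0 _ ww) -Jw ell2_dotE ler0c nsq_ge0.
have JD (a : R[i]) v v' : J (a *: v + v') = a *: J v + J v'.
  exact: analysis_linear.
exists l => // v v'; move: v v'.
(* The eigenspace of that operator for [l], written without the adjoint. It is closed because [J] is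
   bounded, and invariant because [J] intertwines the two unitary actions. *)
pose W v := forall v', ell2_dot (J v) (J v') = l * dot v v'.
suff : forall v, W v by [].
apply: (irreducible_all pi_irr (W := W) (w := w)) => //.
- move=> v vcl v'; apply/eqP; rewrite -subr_eq0; apply/eqP.
  set K := Num.sqrt (m%:R * c ^+ 2).
  have Jn z : ell2_nrm (J z) <= K * nrm z.
    have mc : 0 <= m%:R * c ^+ 2 by rewrite mulr_ge0 ?sqr_ge0.
    rewrite -(@ler_pXn2r _ 2) ?nnegrE ?mulr_ge0 ?sqrtr_ge0 ?nrm_ge0
      ?ell2_nrm_ge0//.
    have K2 : K ^+ 2 = m%:R * c ^+ 2 by exact: sqr_sqrtr.
    by rewrite exprMn K2; exact: (analysis_nrm e_le cls_size cls_dot z).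
  pose C := K * (K * nrm v') + Normc.normc l * nrm v'.
  apply: Normc.eq0_normc; apply/eqP; rewrite eq_le normc_ge0 andbT.
  apply/ler_addgt0Pr => r r0; rewrite add0r.
  have C0 : 0 <= C by rewrite addr_ge0 ?mulr_ge0 ?sqrtr_ge0 ?nrm_ge0 ?normc_ge0.
  have C1 : 0 < C + 1 by rewrite ltr_wpDl.
  have [z Wz vz] := vcl (r / (C + 1)) (divr_gt0 r0 C1).
  have -> : ell2_dot (J v) (J v') - l * dot v v' =
      ell2_dot (J (v - z)) (J v') - l * dot (v - z) v'.
    have -> : J (v - z) = (-1 : R[i]) *: J z + J v by rewrite -JD scaleN1r
      addrC.
    by rewrite ell2_dot_linear_l Wz dotBl; ring.
  apply: le_trans (le_normcD _ _) _; rewrite normcN Normc.normcM.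
  have h1 : Normc.normc (ell2_dot (J (v - z)) (J v')) <=
    K * nrm (v - z) * (K * nrm v').
    apply: le_trans (@cauchy_schwarz _ (ell2_hilbert R Y) (J (v - z)) (J v')) _.
    by apply: ler_pM; rewrite ?nrm_ge0//; exact: Jn.
  have h2 := ler_wpM2l (normc_ge0 l) (cauchy_schwarz (v - z) v').
  apply: le_trans (lerD h1 h2) _.
  have -> : K * nrm (v - z) * (K * nrm v') + Normc.normc l * (nrm (v - z) * nrm
    v') =
    C * nrm (v - z) by rewrite /C; ring.
  rewrite -[leRHS](divfK (lt0r_neq0 C1)) mulrC ler_pM ?nrm_ge0 ?lerDl//.
  exact: ltW.
- by move=> a v z Wv Wz v'; rewrite JD ell2_dot_linear_l Wv Wz dotDl dotZl
  mulrDr mulrCA.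
- move=> g v Wv v'; rewrite -[v'](repV pi g^-1%g) invgK;
  move: (pi g^-1%g v') => z.
  by rewrite !analysis_act shift_dot Wv; congr (l * _); symmetry;
    exact: rep_dot.
Qed.

Lemma analysis_subrep : subrep pi (shift_rep act1 actM act_near).
Proof.
have [l l0 Jl] := analysis_scalar; pose k := sqrtC l^-1.
have kk : k * conjC k = l^-1.
  by rewrite -normCK ger0_norm ?sqrtC_ge0 ?invr_ge0 ?ltW// sqrtCK.
pose J' : {linear H -> ell2 R Y} := analysis e_le cls_size cls_dot.
exists (k \*: J'); split=> [v w|g v].
  change (ell2_hdot R Y (k *: J v) (k *: J w) = dot v w).
  rewrite linearZl_LR linearZr_LR /=.
  have -> : ell2_hdot R Y (J v) (J w) = l * dot v w by exact: Jl.
  by rewrite mulrA kk mulKf// gt_eqF.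
change (k *: J (pi g v) = shift act1 actM g (k *: J v)).
by rewrite analysis_act; symmetry; exact: linearZ.
Qed.

End Embedding.

(** * The embedding *)

Section Assembly.
Variables (R : realType) (L : set R) (U : metricType R).
Hypothesis HU : urysohn L U.
Variables (H : hilbert R) (pi : unitary_rep U H).
Hypothesis pi_irr : irreducible pi.
Variables (n : nat) (x : 'I_n -> U) (D : 'I_n -> set R) (u : H).
Variable p : 'I_n -> ball_kind * \bar R.
Hypothesis cD : forall i, cut (D i).
Hypothesis u_neq0 : u != 0.
Hypothesis u_fixed : fixed pi (pointwise_stab x D) u.
Hypothesis u_extremal : forall g, dot (pi g u) u != 0 -> exists s : {perm 'I_n},
  forall i, D (s i) = D i /\ D i (mdist (x i) (g (x (s i)))).
Hypothesis pD : forall j (z : U), mball (p j).1 z (p j).2 =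
  [set y | D j (mdist z y)].

Local Notation Y := (ball_tuple U p).

Lemma balls_around_subproof (z : 'I_n -> U) j :
  mball (p j).1 (z j) (p j).2 \in @Xi R U (p j).
Proof. by apply/mem_set; exists (z j). Qed.

Definition balls_around (z : 'I_n -> U) : Y :=
  fun j => SigSub (balls_around_subproof z j).

Lemma balls_around_act (g : isom U) z : ball_act g (balls_around z) =
  balls_around (g \o z).
Proof.
apply: functional_extensionality_dep => j; apply: val_inj => /=.
exact: isom_mball.
Qed.

Lemma balls_around_mdist z z' : balls_around z = balls_around z' ->
  forall j, D j (mdist (z j) (z' j)).
Proof.
move=> zz' j; have : val (balls_around z' j) (z' j).
  by rewrite /= pD /= mdistxx; exact: cut0.
by rewrite -zz' /= pD.
Qed.

(* [pi g u] on the orbit of the balls fixed by [u], and [0] off it. *)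
Definition orbit_vector (y : Y) : H :=
  xget 0 [set w | exists g : isom U, y = balls_around (g \o x) /\ w = pi g u].

(** The value does not depend on the choice of [g]: two isometries that carry the balls around [x]
    to the same tuple differ by an element of the stabilizer, which fixes [u]. *)
Lemma orbit_vectorE (g : isom U) : orbit_vector (balls_around (g \o x)) =
  pi g u.
Proof.
apply: xget_subset1; first by exists g.
move=> _ _ [h [gh ->]] [h' [gh' ->]].
have hh' : pointwise_stab x D (h'^-1 * h)%g.
  move=> j; rewrite -(isom_mdist h').
  have -> : h' ((h'^-1 * h)%g (x j)) = h (x j) by exact: isom_invK.
  by apply: (balls_around_mdist (z := h' \o x) (z' := h \o x)); rewrite -gh'.
by rewrite -[in RHS](u_fixed hh') -repM mulgA mulgV mul1g.
Qed.

Lemma orbit_vector0 y : ~ (exists g : isom U, y = balls_around (g \o x)) ->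
  orbit_vector y = 0.
Proof.
move=> ny; apply: xgetPN => w [g [yg _]]; apply: ny; by exists g.
Qed.

Lemma orbit_vector_act g y : orbit_vector (ball_act g y) =
  pi g (orbit_vector y).
Proof.
have [[h ->]|ny] := pselect (exists h : isom U, y = balls_around (h \o x)).
  rewrite balls_around_act orbit_vectorE -repM.
  exact: (orbit_vectorE (g * h)%g).
rewrite (orbit_vector0 ny) linear0 orbit_vector0// => -[h yh]; apply: ny.
exists (g^-1 * h)%g; rewrite -[y](actK (@ball_act1 _ _ _ p) (@ball_actM _ _ _ p)
  g).
by rewrite yh balls_around_act.
Qed.

Lemma nrm_orbit_vector y : nrm (orbit_vector y) <= nrm u.
Proof.
have [[h ->]|ny] := pselect (exists h : isom U, y = balls_around (h \o x)).
  by rewrite orbit_vectorE rep_nrm.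
by rewrite orbit_vector0// nrm0 nrm_ge0.
Qed.

(** The balls are compared as subsets of [U], because the balls at different indices belong to
    different types. *)
Definition permuted (y z : Y) : Prop :=
  exists s : {perm 'I_n}, forall i, val (z i) = val (y (s i)).

Lemma orbit_vector_dot y z :
  dot (orbit_vector y) (orbit_vector z) != 0 -> permuted y z.
Proof.
have [[g ->]|ny] := pselect (exists g : isom U, y = balls_around (g \o x));
  last first.
  by rewrite orbit_vector0// dot0l eqxx.
have [[h ->]|nz] := pselect (exists h : isom U, z = balls_around (h \o x));
  last first.
  by rewrite [X in dot _ X]orbit_vector0// dot0r eqxx.
rewrite !orbit_vectorE => gh.
have [|s sP] := u_extremal (g := (h^-1 * g)%g).
  apply: contra_neq gh => gh; rewrite -gh repM -[LHS](rep_dot pi h^-1%g).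
  by rewrite -[pi h^-1%g (pi h u)]repM mulVg rep1.
exists s => i; have [Di dist] := sP i; rewrite /= !pD Di.
have {}dist : D i (mdist (h (x i)) (g (x (s i)))).
  move: dist; rewrite -(isom_mdist h).
  by have -> : h ((h^-1 * g)%g (x (s i))) = g (x (s i)) by exact: isom_invK.
apply/seteqP; split=> t /= Dt.
  by apply: (cut_mdist HU (cD i)) Dt; rewrite metric_sym.
exact: (cut_mdist HU (cD i) dist).
Qed.

(* The permuted family need not have the right types of balls; where it has not,
   [y i] is a junk value. *)
Definition permute (y : Y) (s : {perm 'I_n}) : Y :=
  fun i => insubd (y i) (val (y (s i))).

Definition permutations_of (y : Y) : seq Y :=
  map (permute y) (enum {: {perm 'I_n}}).

Lemma mem_permutations_of y z : permuted y z -> z \in permutations_of y.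
Proof.
move=> [s sP]; apply/mapP; exists s; first by rewrite mem_enum.
by apply: functional_extensionality_dep => i; rewrite /permute -sP valKd.
Qed.

Lemma size_permutations_of y : (size (permutations_of y) <= #|{perm 'I_n}|)%N.
Proof. by rewrite size_map -cardE. Qed.

Lemma extremal_subrep : subrep pi (ball_rep HU cD pD).
Proof.
pose y0 := balls_around x.
(* The tuples that consist of the balls of [y0] in another order; the filter removes the junk values
   of [permute]. *)
pose Q : {fset Y} := seq_fset tt [seq z <- permutations_of y0 | `[< permuted y0
  z >]].
have memQ z : z \in Q <-> permuted y0 z.
  rewrite seq_fsetE mem_filter; split=> [/andP[/asboolP]//|yz].
  by rewrite mem_permutations_of// andbT; apply/asboolP.
apply: (@analysis_subrep _ _ _ _ pi_irr _ _ _ _ _ orbit_vector Q (nrm u)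
  #|{perm 'I_n}| permutations_of).
- exact: nrm_orbit_vector.
- exact: size_permutations_of.
- by move=> y z /orbit_vector_dot/mem_permutations_of.
- exact: orbit_vector_act.
- move=> y z /memQ[s sP] /orbit_vector_dot[t tP]; apply/memQ.
  by exists (t * s)%g => i; rewrite tP sP permM.
- exists y0; first by apply/memQ; exists 1%g => i; rewrite perm1.
  have -> : orbit_vector y0 = u by rewrite -[RHS](rep1 pi) -orbit_vectorE.
  exact: u_neq0.
Qed.

End Assembly.

Theorem theorem1 (R : realType) (L : set R)
  (L_countable : countable L) (L_pos : forall r, L r -> 0 < r)
  (U : metricType R) (U_urysohn : urysohn L U)
  (H : hilbert R) (H_separable : separable_space H)
  (pi : unitary_rep U H) (pi_irr : irreducible pi) :
  exists (N : nat) (p : 'I_N -> ball_kind * \bar R),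
    [/\ (0 < N)%N,
        forall j, perfect_pair L (p j) &
        exists (T : hilbert R) (tau : (forall j, ell2_Xi U (p j)) -> T)
               (rho : unitary_rep U T),
          tensor_of_ell2 tau rho /\ subrep pi rho].
Proof.
have [n [n_gt0 ex_fixed disj]] := ex_min_has_fixed U_urysohn pi pi_irr.1.
have [x [D [u [cD u0 ux u_ext]]]] :=
  ex_extremal L_pos U_urysohn pi_irr n_gt0 disj ex_fixed.
have /choice[p pP] j := perfect_cut L_pos U_urysohn (cD j).
have pD j : forall z : U,
    mball (p j).1 z (p j).2 = [set y | D j (mdist z y)].
  by have [] := pP j.
exists n, p; split=> // [j|]; first by have [] := pP j.
exists (ell2_hilbert R (ball_tuple U p)), (@tensor n (fun j => @Xi R U (p j)) R),
  (ball_rep U_urysohn cD pD).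
split; first exact: ball_rep_tensor.
exact: (extremal_subrep U_urysohn pi_irr cD u0 ux u_ext pD).
Qed.
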